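(* Let $K$ be a difference-differential field of characteristic zero with basic set of derivations $\Delta=\{\delta_1,\dots,\delta_m\}$ and basic set of automorphisms $\sigma=\{\alpha_1,\dots,\alpha_n\}$, and let a partition $\Delta=\Delta_1\cup\dots\cup\Delta_p$ ($p\ge 1$) into disjoint subsets be fixed, where $\Delta_i=\{\delta_{m_1+\dots+m_{i-1}+1},\dots,\delta_{m_1+\dots+m_i}\}$ and $m_1+\dots+m_p=m$. Let $L=K\langle\eta_1,\dots,\eta_s\rangle$ be a $\Delta$-$\sigma$-field extension of $K$ generated by a finite set $\eta=\{\eta_1,\dots,\eta_s\}$. Then there exists a polynomial $\Phi_\eta(t_1,\dots,t_{p+1})$ in $p+1$ variables with rational coefficients such that: (i) $\Phi_\eta(r_1,\dots,r_{p+1})=\operatorname{trdeg}_K K\big(\bigcup_{j=1}^{s}\Lambda(r_1,\dots,r_{p+1})\eta_j\big)$ for all sufficiently large $(r_1,\dots,r_{p+1})\in\mathbf N^{p+1}$ (i.e., there exist $s_1,\dots,s_{p+1}\in\mathbf N$ such that the equality holds for all $(r_1,\dots,r_{p+1})\in\mathbf N^{p+1}$ with $r_1\ge s_1,\dots,r_{p+1}\ge s_{p+1}$). (ii) $\deg_{t_i}\Phi_\eta\le m_i$ for $1\le i\le p$ and $\deg_{t_{p+1}}\Phi_\eta\le n$, so that $\deg\Phi_\eta\le m+n$ and $\Phi_\eta$ can be represented as $$\Phi_\eta(t_1,\dots,t_{p+1})=\sum_{i_1=0}^{m_1}\dots\sum_{i_p=0}^{m_p}\sum_{i_{p+1}=0}^{n}a_{i_1\dots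 i_{p+1}}\binom{t_1+i_1}{i_1}\dots\binom{t_{p+1}+i_{p+1}}{i_{p+1}}$$ where $a_{i_1\dots i_{p+1}}\in\mathbf Z$ and $2^n\mid a_{m_1\dots m_p n}$. (iii) Let $E_\eta=\{(i_1,\dots,i_{p+1})\in\mathbf N^{p+1}\mid 0\le i_k\le m_k \text{ for } k=1,\dots,p,\ 0\le i_{p+1}\le n,\text{ and } a_{i_1\dots i_{p+1}}\ne 0\}$. Then $d=\deg\Phi_\eta$, the coefficient $a_{m_1\dots m_p n}$, the elements $(k_1,\dots,k_{p+1})\in E_\eta'$, the corresponding coefficients $a_{k_1\dots k_{p+1}}$, and the coefficients of the terms of total degree $d$ do not depend on the choice of the finite system of $\Delta$-$\sigma$-generators $\eta$ of $L/K$. Furthermore, $a_{m_1\dots m_p n}/2^n$ is equal to the difference-differential transcendence degree $\Delta$-$\sigma$-$\operatorname{trdeg}_K L$.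
   Context: $\mathbf N$ is the set of non-negative integers and $\mathbf Z$ is the set of integers. A difference-differential (or $\Delta$-$\sigma$-) field is a field $K$ together with finite sets $\Delta=\{\delta_1,\dots,\delta_m\}$ of derivations and $\sigma=\{\alpha_1,\dots,\alpha_n\}$ of automorphisms of $K$ such that any two mappings in $\Delta\cup\sigma$ commute. A $\Delta$-$\sigma$-field extension $L/K$ is an extension of $\Delta$-$\sigma$-fields with the same basic sets (the operators on $L$ restrict to those on $K$, and $K$ is closed under $\Delta\cup\sigma\cup\sigma^{-1}$, where $\sigma^{-1}=\{\alpha_1^{-1},\dots,\alpha_n^{-1}\}$). $\Lambda$ denotes the free commutative semigroup of all power products $\lambda=\delta_1^{k_1}\dots\delta_m^{k_m}\alpha_1^{l_1}\dots\alpha_n^{l_n}$ with $k_i\in\mathbf N$, $l_j\in\mathbf Z$. $L=K\langle\eta_1,\dots,\eta_s\rangle$ means that $L$ is the smallest $\Delta$-$\sigma$-subfield of $L$ containing $K$ and all $\eta_j$; as a field, $L=K(\{\lambda\eta_j\mid\lambda\in\Lambda,1\le j\le s\})$. For $\lambda=\delta_1^{k_1}\dots\delta_m^{k_m}\alpha_1^{l_1}\dots\alpha_n^{l_n}\in\Lambda$, $\operatorname{ord}_i\lambda=\sum_{\nu=m_1+\dots+m_{i-1}+1}^{m_1+\dots+m_i}k_\nu$ ($1\le i\le p$; for $i=1$ the sum is $k_1+\dots+k_{m_1}$) and $\operatorname{ord}_\sigma\lambda=\sum_{j=1}^n|l_j|$. For $r_1,\dots,r_{p+1}\in\mathbf N$,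 $\Lambda(r_1,\dots,r_{p+1})=\{\lambda\in\Lambda\mid\operatorname{ord}_i\lambda\le r_i\ (i=1,\dots,p),\ \operatorname{ord}_\sigma\lambda\le r_{p+1}\}$, and $\Lambda(r_1,\dots,r_{p+1})\eta_j=\{\lambda\eta_j\mid\lambda\in\Lambda(r_1,\dots,r_{p+1})\}$. For a permutation $(j_1,\dots,j_{p+1})$ of $\{1,\dots,p+1\}$, $<_{j_1,\dots,j_{p+1}}$ is the lexicographic order on $\mathbf N^{p+1}$ that compares the coordinates in the order $j_1,j_2,\dots,j_{p+1}$. For $\Sigma\subseteq\mathbf N^{p+1}$, $\Sigma'$ denotes the set of those $e\in\Sigma$ that are maximal elements of $\Sigma$ with respect to at least one of the $(p+1)!$ orders $<_{j_1,\dots,j_{p+1}}$. $\Delta$-$\sigma$-$\operatorname{trdeg}_K L$ is the maximal number $k$ of elements $\xi_1,\dots,\xi_k\in L$ such that the family $\{\lambda\xi_i\mid\lambda\in\Lambda,1\le i\le k\}$ is algebraically independent over $K$. *)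

(* Defs.v *)
From HB Require Import structures.
From mathcomp Require Import all_boot all_order all_algebra all_fingroup.
From mathcomp Require Import mpoly.

Set Implicit Arguments.
Unset Strict Implicit.
Unset Printing Implicit Defensive.

Import GRing.Theory.
Local Open Scope ring_scope.

(* The operators are indexed families: distinct indices may carry the same
   map, since two operators of an extension may agree on the base field. *)
HB.mixin Record isDSField (m n : nat) F of GRing.Field F := {
  der : 'I_m -> {additive F -> F};
  aut : 'I_n -> {rmorphism F -> F};
  autV : 'I_n -> F -> F;
  derM : forall i (x y : F), der i (x * y) = der i x * y + x * der i y;
  autK : forall j, cancel (aut j) (autV j);
  autVK : forall j, cancel (autV j) (aut j);
  derC : forall i i' (x : F), der i (der i' x) = der i' (der i x);
  autC : forall j j' (x : F), aut j (aut j' x) = aut j' (aut j x);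
  der_autC : forall i j (x : F), der i (aut j x) = aut j (der i x)
}.

#[short(type="dsFieldType")]
HB.structure Definition DSField (m n : nat) :=
  { F of isDSField m n F & GRing.Field F }.

(* The formal power products, i.e. the pairs of exponent vectors (k, l); they
   are kept apart from the operators that they induce. *)
Definition Lam (m n : nat) : Type := ({ffun 'I_m -> nat} * {ffun 'I_n -> int})%type.

Section Operators.
Variables (m n : nat) (F : dsFieldType m n).

Definition autz (j : 'I_n) (z : int) : F -> F :=
  match z with
  | Posz k => iter k (aut (s := F) j)
  | Negz k => iter k.+1 (autV (s := F) j)
  end.

Definition lact (l : Lam m n) (x : F) : F :=
  foldr (fun i y => iter (l.1 i) (der (s := F) i) y)
    (foldr (fun j y => autz j (l.2 j) y) x (enum 'I_n))
    (enum 'I_m).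

Definition is_subfield (S : F -> Prop) : Prop :=
  [/\ S 1,
      forall x y, S x -> S y -> S (x - y)
    & forall x y, S x -> S y -> S (x / y)].

Definition is_ds_closed (S : F -> Prop) : Prop :=
  [/\ forall i x, S x -> S (der i x),
      forall j x, S x -> S (aut j x)
    & forall j x, S x -> S (autV j x)].

End Operators.

Section Orders.
Variables (m n p : nat) (ms : 'I_p -> nat).

Definition ord_blk (i : 'I_p) (l : Lam m n) : nat :=
  (\sum_(v < m | \sum_(j < p | (j < i)%N) ms j <= v
                 < \sum_(j < p | (j <= i)%N) ms j) l.1 v)%N.

Definition ord_sig (l : Lam m n) : nat := (\sum_(j < n) `|l.2 j|)%N.

(* Coordinate i <= p of a (p+1)-tuple is lift ord_max i, coordinate p+1 is
   ord_max. *)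
Definition in_Lam (r : 'I_p.+1 -> nat) (l : Lam m n) : Prop :=
  (forall i : 'I_p, (ord_blk i l <= r (lift ord_max i))%N) /\
  (ord_sig l <= r ord_max)%N.

End Orders.

Section Extension.
Variables (m n : nat) (K L : dsFieldType m n) (iota : {rmorphism K -> L}).

Definition ds_extension : Prop :=
  (forall i x, iota (der i x) = der i (iota x)) /\
  (forall j x, iota (aut j x) = aut j (iota x)).

Definition adjoin (S : L -> Prop) (x : L) : Prop :=
  forall F : L -> Prop, is_subfield F -> (forall c, F (iota c)) ->
    (forall y, S y -> F y) -> F x.

Definition ds_adjoin (S : L -> Prop) (x : L) : Prop :=
  forall F : L -> Prop, is_subfield F -> is_ds_closed F ->
    (forall c, F (iota c)) -> (forall y, S y -> F y) -> F x.

Definition ds_generates (s : nat) (eta : 'I_s -> L) : Prop :=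
  forall x, ds_adjoin (fun y => exists j, y = eta j) x.

Definition alg_indep (I : Type) (x : I -> L) : Prop :=
  forall (q : nat) (f : 'I_q -> I), injective f ->
  forall P : {mpoly K[q]},
    (map_mpoly iota P).@[fun i => x (f i)] = 0 -> P = 0.

Definition is_trdeg (F : L -> Prop) (d : nat) : Prop :=
  (exists x : 'I_d -> L, (forall i, F (x i)) /\ alg_indep x) /\
  (forall d' (x : 'I_d' -> L),
     (forall i, F (x i)) -> alg_indep x -> (d' <= d)%N).

Definition ds_indep (k : nat) (xi : 'I_k -> L) : Prop :=
  alg_indep (fun li : Lam m n * 'I_k => lact li.1 (xi li.2)).

Definition is_ds_trdeg (k : nat) : Prop :=
  (exists xi : 'I_k -> L, ds_indep xi) /\
  (forall k' (xi : 'I_k' -> L), ds_indep xi -> (k' <= k)%N).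

Definition Lam_eta (p : nat) (ms : 'I_p -> nat) (s : nat) (eta : 'I_s -> L)
    (r : 'I_p.+1 -> nat) (y : L) : Prop :=
  exists (j : 'I_s) (l : Lam m n), in_Lam ms r l /\ y = lact l (eta j).

Definition is_dim_poly (p : nat) (ms : 'I_p -> nat) (s : nat)
    (eta : 'I_s -> L) (Phi : {mpoly rat[p.+1]}) : Prop :=
  exists r0 : 'I_p.+1 -> nat, forall r : 'I_p.+1 -> nat,
    (forall i, (r0 i <= r i)%N) ->
    exists d : nat, is_trdeg (adjoin (Lam_eta ms eta r)) d /\
                    Phi.@[fun i => (r i)%:R] = d%:R.

End Extension.

Section Polynomials.
Variable q : nat.

Definition deg_in (i : 'I_q) (P : {mpoly rat[q]}) : nat :=
  \max_(e <- msupp P) e i.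

(* The polynomial binomial coefficient (t_i + k choose k). *)
Definition binX (i : 'I_q) (k : nat) : {mpoly rat[q]} :=
  (k`!%:R)^-1 *: \prod_(1 <= j < k.+1) ('X_i + j%:R).

Definition binom_expansion (b : 'I_q -> nat) (a : 'X_{1..q} -> int) :
    {mpoly rat[q]} :=
  \sum_(e : {dffun forall i : 'I_q, 'I_(b i).+1})
     (a [multinom (e i : nat) | i < q])%:~R *: \prod_(i < q) binX i (e i).

Definition coef_supp (b : 'I_q -> nat) (a : 'X_{1..q} -> int)
    (e : 'X_{1..q}) : Prop :=
  (forall i, (e i <= b i)%N) /\ a e <> 0.

Definition lex_lt (w : 'S_q) (e f : 'X_{1..q}) : Prop :=
  exists k : 'I_q, (forall l : 'I_q, (l < k)%N -> e (w l) = f (w l)) /\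
                   (e (w k) < f (w k))%N.

Definition lex_maximal (S : 'X_{1..q} -> Prop) (e : 'X_{1..q}) : Prop :=
  S e /\ exists w : 'S_q, forall f, S f -> ~ lex_lt w e f.

End Polynomials.

(* The tuple (m_1, ..., m_p, n). *)
Definition bounds (p : nat) (ms : 'I_p -> nat) (n : nat) (i : 'I_p.+1) : nat :=
  oapp ms n (unlift ord_max i).

(* Main.v *)
(* For S in L let cl S be the set of elements killed by all K-derivations of L that kill
   S. Commutators with the delta_i and conjugates by the alpha_j of a K-derivation are
   K-derivations, so cl is stable under the operators; and since derivations extend in
   characteristic zero, the rank of cl is the transcendence degree.

   Order the pairs (lambda, j) by j, then ord_sigma lambda, then lexicographically. For r
   fixed, trdeg_K K(Lambda(r) eta) counts those (lambda, j) with lambda in Lambda(r) for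
   which lambda eta_j is not in the closure of the smaller mu eta_i, mu in Lambda(r). On
   each orthant of Z^n the triples (r, lambda, j) not counted form an upset once
   r - ord lambda is added as slack variables. By Dickson's lemma and inclusion-exclusion
   the number of vectors of degree r outside an upset is eventually a combination of
   products of binomials prod C(r_i - g_i + m_i, m_i), whose coefficients add up to 1 if
   the upset is empty and to 0 otherwise. Whether it is empty depends on j only, since the
   alpha's move a dependence into any orthant: hence the factor 2^n. The eta_j with empty
   upsets form a maximal Delta-sigma-independent family.

   Two systems of generators satisfy Phi(r) <= Phi'(r + c) and Phi'(r) <= Phi(r + c).
   Along r_i = x_i u^(w_i), u -> oo, this forces the parts of highest w-degree to agree for
   every positive weight w: weight 1 gives the top degree part, and weights B^i give the
   lexicographic maxima. *)
Require Import Defs.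
From HB Require Import structures.
From mathcomp Require Import all_boot all_order all_algebra all_fingroup.
From mathcomp Require Import mpoly.
From mathcomp Require Import ring zify.
From mathcomp Require boolp classical_sets.
From Stdlib Require Import Classical ClassicalEpsilon.

Set Implicit Arguments.
Unset Strict Implicit.
Unset Printing Implicit Defensive.

Import Order.TTheory GRing.Theory Num.Theory.
(* [all_fingroup] shadows [aut]. *)
Import Defs.
Local Open Scope ring_scope.

(** * Extension of derivations *)

(** Derivations turn algebraic independence into linear algebra: a family in which no member lies in
    the closure of its predecessors has, after Gaussian elimination, a dual family of derivations,
    and dual derivations refute polynomial relations. The obstacle in the count is that leaders
    cannot be chosen once for all [r]. A smaller element of the order may have larger block orders,
    so a dependence can become visible only for larger [r]. With slack variables raising [r] is
    itself a coordinate direction, and applying an operator raises [r] and [lambda] together while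
    the slack stays fixed; this makes dependence an upset. Maximality of the independent family
    comes from the count as well. Any Delta-sigma-independent [xi_1, ..., xi_k'] has its own
    counting polynomial, in which all upsets are empty, so its top coefficient is [2^n k']. Each
    [xi_i] is algebraic over boundedly many power products of [eta], hence this polynomial is at
    most a shift of that of [eta], and comparing top coefficients gives [k' <= k]. *)

Section PartialDerivations.
Variable L : fieldType.
Implicit Types (G : L * L -> Prop) (f g : {poly L}).

(* The graph of a derivation from a subring of [L] to [L]. *)
Definition pder G : Prop :=
  [/\ G (1, 0),
      forall a a' b b', G (a, a') -> G (b, b') -> G (a - b, a' - b'),
      forall a a' b b', G (a, a') -> G (b, b') -> G (a * b, a' * b + a * b')
    & forall b, G (0, b) -> b = 0].

Section Closure.
Variables (G : L * L -> Prop) (pG : pder G).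

Lemma pder0 : G (0, 0).
Proof. by case: pG => G1 GB _ _; move: (GB _ _ _ _ G1 G1); rewrite !subrr. Qed.

Lemma pderN a a' : G (a, a') -> G (- a, - a').
Proof.
by case: pG => _ GB _ _ Ga; move: (GB _ _ _ _ pder0 Ga); rewrite !sub0r.
Qed.

Lemma pderB a a' b b' : G (a, a') -> G (b, b') -> G (a - b, a' - b').
Proof. by case: pG => _ GB _ _; apply: GB. Qed.

Lemma pderD a a' b b' : G (a, a') -> G (b, b') -> G (a + b, a' + b').
Proof.
by move=> Ga /pderN Gb; move: (pderB Ga Gb); rewrite !opprK.
Qed.

Lemma pderM a a' b b' :
  G (a, a') -> G (b, b') -> G (a * b, a' * b + a * b').
Proof. by case: pG => _ _ GM _; apply: GM. Qed.

Lemma pderMn a a' k : G (a, a') -> G (a *+ k, a' *+ k).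
Proof.
move=> Ga; elim: k => [|k IHk]; first exact: pder0.
by rewrite !mulrS; apply: pderD.
Qed.

Lemma pder_sum (I : Type) (s : seq I) (F F' : I -> L) :
  (forall i, G (F i, F' i)) -> G (\sum_(i <- s) F i, \sum_(i <- s) F' i).
Proof.
move=> GF; elim: s => [|i s IHs]; first by rewrite !big_nil; exact: pder0.
by rewrite !big_cons; apply: pderD.
Qed.

Lemma pder_fun a b b' : G (a, b) -> G (a, b') -> b = b'.
Proof.
case: pG => _ GB _ G0 Gb Gb'; move: (GB _ _ _ _ Gb Gb').
by rewrite subrr => /G0/eqP; rewrite subr_eq0 => /eqP.
Qed.

(** [g] stands for [f] with the derivation applied to its coefficients; this is a relation because
    [G] is only partial. *)
Definition cpair f g : Prop := forall i, G (f`_i, g`_i).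

Lemma cpair1 : cpair 1 0.
Proof.
move=> i; rewrite coef1 coef0; case: eqP => _; last exact: pder0.
by case: pG.
Qed.

Lemma cpairX : cpair 'X 0.
Proof.
move=> i; rewrite coefX coef0; case: eqP => _; last exact: pder0.
by case: pG.
Qed.

Lemma cpairC a a' : G (a, a') -> cpair a%:P a'%:P.
Proof. by move=> Ga i; rewrite !coefC; case: eqP => _ //; exact: pder0. Qed.

Lemma cpairB f g f1 g1 : cpair f g -> cpair f1 g1 -> cpair (f - f1) (g - g1).
Proof. by move=> H H1 i; rewrite !coefB; apply: pderB. Qed.

Lemma cpairM f g f1 g1 :
  cpair f g -> cpair f1 g1 -> cpair (f * f1) (g * f1 + f * g1).
Proof.
move=> H H1 i; rewrite coefD !coefM -big_split /=.
by apply: pder_sum => j; apply: pderM.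
Qed.

Lemma cpairXn k : cpair 'X^k 0.
Proof.
elim: k => [|k IHk]; first by rewrite expr0; exact: cpair1.
by move: (cpairM cpairX IHk); rewrite -exprS mul0r mulr0 addr0.
Qed.

Lemma cpair_eq0 g : cpair 0 g -> g = 0.
Proof.
move=> H; apply/polyP => i; rewrite coef0; case: pG => _ _ _ G0.
by apply: G0; move: (H i); rewrite coef0.
Qed.

Section Adjoin.
Variables (z z' : L).

(** The value that the Leibniz rule forces on [f.[z]] once [z] is sent to [z']. *)
Definition tangent f g : L := g.[z] + f^`().[z] * z'.

Lemma tangentB f g f1 g1 :
  tangent (f - f1) (g - g1) = tangent f g - tangent f1 g1.
Proof. by rewrite /tangent derivB !hornerD !hornerN; ring. Qed.

Lemma tangentM f g f1 g1 :
  tangent (f * f1) (g * f1 + f * g1) =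
    tangent f g * f1.[z] + f.[z] * tangent f1 g1.
Proof. by rewrite /tangent derivM !hornerD !hornerM; ring. Qed.

Definition pder_adjoin (u : L * L) : Prop :=
  exists f g, [/\ cpair f g, u.1 = f.[z] & u.2 = tangent f g].

Lemma pder_adjoinP :
  (forall f g, cpair f g -> f.[z] = 0 -> tangent f g = 0) ->
  pder pder_adjoin.
Proof.
move=> T0; split.
- exists 1, 0; split; [exact: cpair1 | by rewrite hornerC|].
  by rewrite /tangent horner0 derivC horner0 mul0r addr0.
- move=> a a' b b' [f [g [/= H -> ->]]] [f1 [g1 [/= H1 -> ->]]].
  exists (f - f1), (g - g1); split; first exact: cpairB.
    by rewrite hornerD hornerN.
  by rewrite tangentB.
- move=> a a' b b' [f [g [/= H -> ->]]] [f1 [g1 [/= H1 -> ->]]].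
  exists (f * f1), (g * f1 + f * g1); split; first exact: cpairM.
    by rewrite hornerM.
  by rewrite tangentM.
- by move=> b [f [g [/= H f0 ->]]]; apply: T0.
Qed.

Lemma pder_adjoin_sub u : G u -> pder_adjoin u.
Proof.
case: u => a a' Ga; exists a%:P, a'%:P; split; first exact: cpairC.
  by rewrite hornerC.
by rewrite /tangent derivC horner0 hornerC mul0r addr0.
Qed.

Lemma pder_adjoin_gen : pder_adjoin (z, z').
Proof.
exists 'X, 0; split; [exact: cpairX | by rewrite hornerX |].
by rewrite /tangent derivX horner0 hornerC add0r mul1r.
Qed.

End Adjoin.

Hypothesis char0 : forall k, k.+1%:R != 0 :> L.

(* If [p] is of minimal degree among the polynomials vanishing at [z], then the value at
   [z] is forced to be [- p^D(z) / p'(z)]; without such [p] any value will do. *)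
Lemma pder_extend z : exists z', pder (pder_adjoin z z').
Proof.
case: (classic (exists k f g, [/\ size f = k.+1, cpair f g & f.[z] = 0])).
  move=> ex.
  pose P k := exists f g, [/\ size f = k.+1, cpair f g & f.[z] = 0].
  have [k [Pk kmin]] : exists k, P k /\ forall l, P l -> (k <= l)%N.
    case: ex => k; move: {2}k.+1 (leqnn k.+1) => N; elim: N k => // N IH k kN Pk.
    case: (classic (exists2 l, P l & (l < k)%N)) => [[l Pl lk]|no].
      by apply: (IH l) => //; apply: leq_trans lk _.
    exists k; split=> // l Pl; rewrite leqNgt; apply/negP => lk.
    by apply: no; exists l.
  case: Pk => p [pD [sp Hp pz]].
  have small f g : cpair f g -> f.[z] = 0 -> (size f <= k)%N -> f = 0.
    move=> H fz sf; apply/eqP; rewrite -size_poly_eq0.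
    case sfE: (size f) => [//|l]; have Pl : P l by exists f, g.
    by move: (kmin _ Pl); rewrite leqNgt -sfE sf.
  have cder f g : cpair f g -> cpair f^`() g^`().
    by move=> H i; rewrite !coef_deriv; apply: pderMn.
  (* The derivative has smaller size and still carries coefficient derivatives, so vanishing at [z]
     would make it zero by minimality; in characteristic zero [p] would then lose its leading
     coefficient. *)
  have p'z : p^`().[z] != 0.
    apply/eqP => p'z; have k_gt0 : (0 < k)%N.
      rewrite lt0n; apply/eqP => k0; rewrite k0 in sp.
      have /size_poly1P[c c0 pE] : size p == 1 by rewrite sp.
      by move: pz c0; rewrite pE hornerC => ->; rewrite eqxx.
    have p'0 : p^`() = 0.
      apply: (small _ _ (cder _ _ Hp) p'z).
      by have := lt_size_deriv (p := p); rewrite -size_poly_eq0 sp => /(_ isT).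
    have := congr1 (fun q : {poly L} => q`_k.-1) p'0.
    rewrite coef_deriv coef0 prednK // => /eqP.
    rewrite -mulr_natr mulf_eq0 -{2}(prednK k_gt0) (negbTE (char0 _)) orbF.
    by move=> /eqP lp; have /eqP := lead_coefE p; rewrite sp lp lead_coef_eq0
      -size_poly_eq0 sp.
  exists (- pD.[z] / p^`().[z]); set z' := - _ / _.
  have Tp : tangent z z' p pD = 0.
    by rewrite /tangent /z' mulrC divfK // addrN.
  apply: pder_adjoinP => f g.
  move: {2}(size f).+1 (leqnn (size f).+1) => N.
  elim: N f g => // N IH f g sf H fz.
  case: (leqP (size f) k) => [sfk|ksf].
    have f0 := small _ _ H fz sfk; rewrite f0 in H *.
    by rewrite (cpair_eq0 H) /tangent derivC !horner0 mul0r addr0.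
  (* Pseudo-division: the coefficients only form a ring, so [f] is multiplied by the leading
     coefficient [a] of [p] before [c X^e p] is subtracted. The difference has smaller size, and its
     tangent value is [a] times that of [f]. *)
  pose e := ((size f).-1 - k)%N.
  pose a := lead_coef p; pose a' := pD`_k.
  pose c := lead_coef f; pose c' := g`_(size f).-1.
  have Ga : G (a, a') by rewrite /a lead_coefE sp; apply: Hp.
  have Gc : G (c, c') by rewrite /c lead_coefE; apply: H.
  have H1 := cpairM (cpairC Ga) H.
  have H2 := cpairM (cpairM (cpairC Gc) (cpairXn e)) Hp.
  have a0 : a != 0 by rewrite lead_coef_eq0 -size_poly_eq0 sp.
  have c0 : c != 0 by rewrite lead_coef_eq0 -size_poly_gt0 (leq_trans _ ksf).
  have := IH _ _ _ (cpairB H1 H2) _.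
  rewrite tangentB !tangentM Tp pz fz !mulr0 !add0r subr0 hornerC => T0.
  have : a * tangent z z' f g = 0.
    apply: T0; last by rewrite !hornerE pz fz !mulr0 subr0.
    have s2 : size ('X^e * p) = size f.
      by rewrite mulrC size_mulXn ?sp -?size_poly_eq0 ?sp // /e; lia.
    rewrite mul_polyC -mulrA mul_polyC; apply: (@leq_trans (size f)) => //.
    have f_gt0 : (0 < size f)%N by rewrite (leq_trans _ ksf).
    rewrite -[X in (_ < X)%N]prednK // ltnS.
    apply/leq_sizeP => j; rewrite leq_eqVlt => /predU1P[<-|lt_j].
      rewrite coefB !coefZ -lead_coefE -s2 -lead_coefE lead_coefM.
      by rewrite lead_coefXn mul1r mulrC subrr.
    have sj : (size f <= j)%N by rewrite -(prednK f_gt0).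
    by rewrite coefB !coefZ !nth_default ?s2 // !mulr0 subr0.
  by move/eqP; rewrite mulf_eq0 (negbTE a0) => /eqP.
move=> no; exists 0; apply: pder_adjoinP => f g H fz.
have f0 : f = 0.
  apply/eqP; rewrite -size_poly_eq0; case sf: (size f) => [//|k].
  by case: no; exists k, f, g.
rewrite f0 in H *.
by rewrite (cpair_eq0 H) /tangent derivC !horner0 mul0r addr0.
Qed.

End Closure.

(** By [pder_extend] a maximal graph is total. Inverses are covered by its algebraic case, [a^-1]
    being a root of [a X - 1]. *)
Lemma pder_total G : (forall k, k.+1%:R != 0 :> L) -> pder G ->
  exists D : L -> L, [/\ forall x y, D (x + y) = D x + D y,
    forall x y, D (x * y) = D x * y + x * D y & forall u, G u -> D u.1 = u.2].
Proof.
move=> char0 pG.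
pose P A := A = classical_sets.set0 \/ (pder A /\ forall u, G u -> A u).
have [F FP tot|A [PA Amax]] := @classical_sets.Zorn_bigcup _ P.
  case: (classic (exists2 A, F A & A <> classical_sets.set0)); last first.
    move=> no; left; apply: boolp.funext => u; apply: boolp.propext.
    split=> // -[A FA Au]; case: no; exists A => // A0.
    by move: Au; rewrite A0.
  move=> [A0 FA0 A0n].
  have pF A u : F A -> A u -> pder A.
    by move=> FA Au; case: (FP _ FA) => [E|[]//]; rewrite E in Au.
  have GA0 u : G u -> A0 u by case: (FP _ FA0) => // -[_]; apply.
  have two u v : (exists2 A, F A & A u) -> (exists2 A, F A & A v) ->
      exists A, [/\ F A, A u & A v].
    move=> [A FA Au] [B FB Bv]; case: (tot _ _ FA FB) => AB.
      by exists B; split=> //; apply: AB.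
    by exists A; split=> //; apply: AB.
  right; split; last by move=> u Gu; exists A0 => //; apply: GA0.
  split.
  - by exists A0 => //; apply: GA0; case: pG.
  - move=> a a' b b' Ha Hb; have [B [FB Ba Bb]] := two _ _ Ha Hb.
    by exists B => //; apply: pderB => //; apply: pF Ba.
  - move=> a a' b b' Ha Hb; have [B [FB Ba Bb]] := two _ _ Ha Hb.
    by exists B => //; apply: pderM => //; apply: pF Ba.
  - move=> b [B FB Bb]; have [_ _ _] := pF _ _ FB Bb; exact.
have {PA} [pA GA] : pder A /\ forall u, G u -> A u.
  case: PA => // A0; case: (Amax G); last by right.
  split=> [u|/(_ (1, 0))]; rewrite A0 // => /(_ _)[]//.
  by case: pG.
have tot z : exists z', A (z, z').
  have [z' pz'] := pder_extend pA char0 z; exists z'.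
  apply: NNPP => nA; case: (Amax (pder_adjoin A z z')).
    split=> [u|/(_ (z, z'))/(_ (pder_adjoin_gen pA _ _))//].
    exact: pder_adjoin_sub.
  by right; split=> // u /GA; apply: pder_adjoin_sub.
have [D DP] : exists D : L -> L, forall z, A (z, D z).
  exists (fun z => proj1_sig (constructive_indefinite_description _ (tot z))).
  by move=> z; case: constructive_indefinite_description.
exists D; split=> [x y|x y|[a a'] /GA Aa].
- by apply: (pder_fun pA (DP _)); apply: pderD.
- by apply: (pder_fun pA (DP _)); apply: pderM.
- exact: (pder_fun pA (DP _)).
Qed.

End PartialDerivations.

(** * The closure defined by derivations *)

Section DifferentialClosure.
Variables (K L : fieldType) (iota : {rmorphism K -> L}).
Implicit Types (S T : L -> Prop) (D : L -> L).

Section Evaluation.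
Variables (q : nat) (x : 'I_q -> L).

Definition ev (P : {mpoly K[q]}) : L := (map_mpoly iota P).@[x].

Lemma evD P Q : ev (P + Q) = ev P + ev Q.
Proof. by rewrite /ev (rmorphD (map_mpoly iota)) mevalD. Qed.

Lemma evB P Q : ev (P - Q) = ev P - ev Q.
Proof. by rewrite /ev (rmorphB (map_mpoly iota)) mevalB. Qed.

Lemma evM P Q : ev (P * Q) = ev P * ev Q.
Proof. by rewrite /ev (rmorphM (map_mpoly iota)) mevalM. Qed.

Lemma evC c : ev c%:MP = iota c.
Proof. by rewrite /ev map_mpolyC mevalC. Qed.

Lemma evXU i : ev 'X_i = x i.
Proof. by rewrite /ev map_mpolyX mevalXU. Qed.

Lemma ev0 : ev 0 = 0.
Proof. by rewrite -mpolyC0 evC rmorph0. Qed.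

Lemma ev1 : ev 1 = 1.
Proof. by rewrite -mpolyC1 evC rmorph1. Qed.

Lemma ev_mderivXU i j : ev (mderiv i 'X_j) = (i == j)%:R.
Proof.
rewrite mderivX mnm1E eq_sym; case: eqP => [->|_].
  have -> : (U_(j) - U_(j) = 0 :> 'X_{1..q})%MM.
    by apply/mnmP => k; rewrite mnmBE subnn mnm0E.
  by rewrite scale1r mpolyX0 ev1.
by rewrite scale0r ev0.
Qed.

End Evaluation.

Definition kder D : Prop :=
  [/\ forall x y, D (x + y) = D x + D y,
      forall x y, D (x * y) = D x * y + x * D y
    & forall c, D (iota c) = 0].

(* In characteristic zero these are the elements algebraic over [K(S)]. *)
Definition cl S (x : L) : Prop :=
  forall D, kder D -> (forall y, S y -> D y = 0) -> D x = 0.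

Section KDerivation.
Variables (D : L -> L) (kD : kder D).

Lemma kderD x y : D (x + y) = D x + D y.
Proof. by case: kD => ->. Qed.

Lemma kderM x y : D (x * y) = D x * y + x * D y.
Proof. by case: kD => _ ->. Qed.

Lemma kder_iota c : D (iota c) = 0.
Proof. by case: kD => _ _ ->. Qed.

Lemma kder0 : D 0 = 0.
Proof. by rewrite -{1}(rmorph0 iota) kder_iota. Qed.

Lemma kder1 : D 1 = 0.
Proof. by rewrite -(rmorph1 iota) kder_iota. Qed.

Lemma kderN x : D (- x) = - D x.
Proof. by apply/eqP; rewrite -addr_eq0 -kderD addNr kder0. Qed.

Lemma kderB x y : D (x - y) = D x - D y.
Proof. by rewrite kderD kderN. Qed.

Lemma kderV x : D x = 0 -> D x^-1 = 0.
Proof.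
have [-> _|x0 Dx] := eqVneq x 0; first by rewrite invr0 kder0.
have := kder1; rewrite -(divff x0) kderM Dx mul0r add0r => /eqP.
by rewrite mulf_eq0 (negbTE x0) => /eqP.
Qed.

Lemma kder_ev q (x : 'I_q -> L) (P : {mpoly K[q]}) :
  D (ev x P) = \sum_i ev x (mderiv i P) * D (x i).
Proof.
pose R (P : {mpoly K[q]}) := D (ev x P) = \sum_i ev x (mderiv i P) * D (x i).
have RD Q1 Q2 : R Q1 -> R Q2 -> R (Q1 + Q2).
  rewrite /R evD kderD => -> ->; rewrite -big_split /=.
  by apply: eq_bigr => i _; rewrite mderivD evD mulrDl.
have RM Q1 Q2 : R Q1 -> R Q2 -> R (Q1 * Q2).
  rewrite /R evM kderM => -> ->.
  rewrite mulr_suml mulr_sumr -big_split /=; apply: eq_bigr => i _.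
  rewrite mderivM evD !evM; move: (ev x Q1) (ev x Q2) (D _) => a b c.
  by move: (ev x _) (ev x _) => d e; ring.
have RC c : R c%:MP.
  rewrite /R evC kder_iota big1 // => i _.
  by rewrite mderivC ev0 mul0r.
have RX i : R 'X_i.
  rewrite /R evXU (bigD1 i) //= big1 ?addr0.
    by rewrite ev_mderivXU eqxx mul1r.
  by move=> j ji; rewrite ev_mderivXU (negbTE ji) mul0r.
elim/mpolyind: P => [|c a P _ _ RP]; first by rewrite -mpolyC0; apply: (RC).
apply: RD RP; rewrite -mul_mpolyC; apply: (RM) => //.
rewrite mpolyXE_id; apply: big_ind => [|Q1 Q2|i _].
- by rewrite -mpolyC1.
- exact: RM.
elim: (a i) => [|k IHk]; first by rewrite expr0 -mpolyC1.
by rewrite exprS; apply: (RM).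
Qed.

End KDerivation.

Lemma kder_lin (I : Type) (s : seq I) (c : I -> L) (F : I -> L -> L) :
  (forall i, kder (F i)) -> kder (fun x => \sum_(i <- s) c i * F i x).
Proof.
move=> kF; split=> [x y|x y|a].
- by rewrite -big_split /=; apply: eq_bigr => i _; rewrite kderD // mulrDr.
- rewrite mulr_suml mulr_sumr -big_split /=; apply: eq_bigr => i _.
  by rewrite kderM //; ring.
- by apply: big1 => i _; rewrite kder_iota // mulr0.
Qed.

Lemma kder_addZ c D E : kder D -> kder E -> kder (fun x => D x + c * E x).
Proof.
move=> kD kE; split=> [x y|x y|a].
- by rewrite !(kderD kD, kderD kE); ring.
- by rewrite !(kderM kD, kderM kE); ring.
- by rewrite (kder_iota kD) (kder_iota kE) mulr0 addr0.
Qed.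

Lemma cl_in S x : S x -> cl S x.
Proof. by move=> Sx D _; apply. Qed.

Lemma cl_trans S T x : (forall y, S y -> cl T y) -> cl S x -> cl T x.
Proof. by move=> ST clx D kD D0; apply: clx => // y /ST; apply. Qed.

Lemma cl_sub S T x : (forall y, S y -> T y) -> cl S x -> cl T x.
Proof. by move=> ST; apply: cl_trans => y /ST; apply: cl_in. Qed.

Lemma cl_iota S c : cl S (iota c).
Proof. by move=> D kD _; apply: kder_iota. Qed.

Section CharacteristicZero.
Hypothesis char0 : forall k, k.+1%:R != 0 :> L.

(** The partial derivative by the [i]-th variable is well defined on values [ev x P] because
    evaluation is injective; it is then extended to [L]. *)
Lemma alg_indep_dual q (x : 'I_q -> L) :
  (forall P, ev x P = 0 -> P = 0) ->
  forall i, exists D, kder D /\ forall j, D (x j) = (i == j)%:R.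
Proof.
move=> ind i.
pose G (u : L * L) := exists P, u = (ev x P, ev x (mderiv i P)).
have pG : pder G.
  split.
  - by exists 1; rewrite -mpolyC1 mderivC mpolyC1 ev0 ev1.
  - move=> a a' b b' [P [-> ->]] [Q [-> ->]]; exists (P - Q).
    by rewrite mderivB !evB.
  - move=> a a' b b' [P [-> ->]] [Q [-> ->]]; exists (P * Q).
    by rewrite mderivM evD !evM.
  - move=> b [P [/esym P0 ->]]; have -> : P = 0 by apply: ind.
    by rewrite mderiv0 ev0.
have [D [DD DM DG]] := pder_total char0 pG; exists D; split; first split=> //.
  by move=> c; apply: (DG (_, _)); exists c%:MP; rewrite mderivC evC ev0.
by move=> j; apply: (DG (_, _)); exists 'X_j; rewrite evXU ev_mderivXU.
Qed.

(** Converse of [alg_indep_dual], by induction on the degree: the dual derivations carry a relation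
    [P] to its partial derivatives, which are relations of smaller degree and therefore zero. *)
Lemma dual_ev_eq0 q (x : 'I_q -> L) :
  (forall i, exists D, kder D /\ forall j, D (x j) = (i == j)%:R) ->
  forall P : {mpoly K[q]}, ev x P = 0 -> P = 0.
Proof.
move=> dual P; have [N] := ubnP (msize P); elim: N P => // N IHN P sP P0.
have [->//|nzP] := eqVneq P 0.
have sP0 : (0 < msize P)%N by rewrite lt0n msize_poly_eq0.
have dP i : mderiv i P = 0.
  have [D [kD Dx]] := dual i; apply: IHN.
    apply: (@leq_ltn_trans (msize P).-1); last by lia.
    rewrite msizeE; apply/bigmax_leqP_seq => a; rewrite mcoeff_msupp => da _.
    have : (a + U_(i))%MM \in msupp P.
      rewrite mcoeff_msupp; apply: contra_neq da => Pa.
      by rewrite mcoeff_deriv Pa mul0rn.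
    by move/msize_mdeg_lt; rewrite mdegD mdeg1; lia.
  have := kder_ev kD x P; rewrite P0 kder0 // (bigD1 i) //= big1.
    by rewrite Dx eqxx mulr1 addr0.
  by move=> j ji; rewrite Dx eq_sym (negbTE ji) mulr0.
(* In characteristic zero, vanishing partial derivatives leave only the constant term. *)
have Pa a : a != 0%MM -> P@_a = 0.
  rewrite -mdeg_eq0 mdegE sum_nat_eq0 negb_forall => /existsP[i ai].
  have Ua : (U_(i) <= a)%MM by rewrite lep1mP.
  have := mcoeff_deriv i (a - U_(i))%MM P.
  rewrite dP mcoeff0 submK // => /esym/eqP; rewrite -mulr_natr mulf_eq0.
  case/orP => [/eqP//|]; rewrite -(fmorph_eq0 iota) rmorph_nat.
  by rewrite (negbTE (char0 _)).
have PC : P = (P@_0)%:MP.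
  apply/mpolyP => a; rewrite mcoeffC; case: (eqVneq a 0%MM) => [->|/Pa->].
    by rewrite mulr1.
  by rewrite mulr0.
move: P0; rewrite PC evC => /eqP; rewrite fmorph_eq0 => /eqP ->.
by rewrite mpolyC0.
Qed.

(** * Greedy bases of a finite ordered family *)

Section Greedy.
Variables (I : eqType) (lt : rel I) (x : I -> L).
Hypotheses (lt_irr : irreflexive lt) (lt_trans : transitive lt).

Definition lower (s : seq I) (i : I) (y : L) : Prop :=
  exists j, [/\ j \in s, lt j i & y = x j].

Definition indep_at (s : seq I) (i : I) : bool :=
  boolp.asbool (~ cl (lower s i) (x i)).

Lemma indep_atP s i : reflect (~ cl (lower s i) (x i)) (indep_at s i).
Proof. exact: boolp.asboolP. Qed.

Lemma lower_rcons s i j : pairwise lt (rcons s i) -> j \in s ->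
  indep_at (rcons s i) j = indep_at s j.
Proof.
rewrite pairwise_rcons => /andP[/allP si _] js.
have low y : lower (rcons s i) j y <-> lower s j y.
  split=> -[k [ks kj ->]]; exists k; split=> //; last first.
    by rewrite mem_rcons inE ks orbT.
  move: ks; rewrite mem_rcons inE => /predU1P[ki|//].
  by have := lt_trans (si _ js); rewrite -ki => /(_ _ kj); rewrite lt_irr.
by apply/indep_atP/indep_atP => H; apply: contra_not H; apply: cl_sub => y /low.
Qed.

Lemma lower_last s i : pairwise lt (rcons s i) ->
  forall y, lower (rcons s i) i y <-> exists2 j, j \in s & y = x j.
Proof.
rewrite pairwise_rcons => /andP[/allP si _] y; split=> [[j [+ ji ->]]|[j js ->]].
  rewrite mem_rcons inE => /predU1P[E|js]; last by exists j.
  by rewrite E lt_irr in ji.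
by exists j; split; rewrite ?mem_rcons ?inE ?js ?orbT ?si.
Qed.

(** The bound [j = i \/ lt j i] is the point: an element is spanned by independent elements up to
    itself. [never_orthant] relies on it. *)
Lemma greedy_span s i : pairwise lt s -> i \in s ->
  cl (fun y => exists j, [/\ j \in s, indep_at s j, j = i \/ lt j i & y = x j]) (x i).
Proof.
elim/last_ind: s i => // s k IHs i pw; have := pw; rewrite pairwise_rcons.
move=> /andP[/allP sk pws].
have up j y : j \in s -> (exists l,
    [/\ l \in s, indep_at s l, l = j \/ lt l j & y = x l]) ->
  exists l, [/\ l \in rcons s k, indep_at (rcons s k) l, l = j \/ lt l j & y = x l].
  move=> js [l [ls il lj ->]]; exists l; split=> //.
    by rewrite mem_rcons inE ls orbT.
  by rewrite lower_rcons.
rewrite mem_rcons inE => /predU1P[->|is_]; last first.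
  by apply: cl_sub (IHs _ pws is_) => y; apply: up.
case: (boolP (indep_at (rcons s k) k)) => [ik|/indep_atP/NNPP].
  by apply: cl_in; exists k; rewrite mem_rcons inE eqxx; split=> //; left.
apply: cl_trans => y /(lower_last pw)[j js ->].
apply: cl_sub (IHs _ pws js) => z /(up _ _ js)[l [ls il lj ->]].
exists l; split=> //; right; case: lj => [->|lj]; first exact: sk.
exact: lt_trans lj (sk _ js).
Qed.

(** Gaussian elimination: a derivation that kills all predecessors of a new independent element is
    used to correct the derivations found before. *)
Lemma greedy_dual s i : pairwise lt s -> i \in s -> indep_at s i ->
  exists D, [/\ kder D, D (x i) = 1 &
    forall j, j \in s -> indep_at s j -> j != i -> D (x j) = 0].
Proof.
elim/last_ind: s i => // s k IHs i pw; have := pw; rewrite pairwise_rcons.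
move=> /andP[/allP sk pws].
have [ik|nik] := boolP (indep_at (rcons s k) k); last first.
  rewrite mem_rcons inE => /predU1P[->|is_]; first by rewrite (negbTE nik).
  rewrite lower_rcons // => /(IHs _ pws is_)[D [kD Di Dj]].
  exists D; split=> // j; rewrite mem_rcons inE => /predU1P[->|js].
    by rewrite (negbTE nik).
  by rewrite lower_rcons //; apply: Dj.
have [E [kE Es Ek]] : exists E, [/\ kder E, forall j,
  j \in s -> E (x j) = 0 & E (x k) = 1].
  (* Outside the closure there is a derivation that kills the predecessors but not [x k]; it is
     rescaled to the value 1. The summand [0] gives it the shape of [kder_addZ]. *)
  move/indep_atP: ik => nk; apply: NNPP => no; apply: nk => D kD D0.
  apply/eqP/negP => /negP Dk; apply: no; exists (fun y => 0 + (D (x k))^-1 * D y).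
  split; last by rewrite add0r mulVf.
    by apply: kder_addZ kD; split=> *; rewrite ?mul0r ?mulr0 ?addr0.
  by move=> j js; rewrite (D0 (x j)) ?mulr0 ?addr0 //; apply/(lower_last pw); exists j.
rewrite mem_rcons inE => /predU1P[-> _|is_].
  exists E; split=> // j; rewrite mem_rcons inE => /predU1P[->|js _ _].
    by rewrite eqxx.
  exact: Es.
rewrite lower_rcons // => /(IHs _ pws is_)[D [kD Di Dj]].
exists (fun y => D y + (- D (x k)) * E y); split.
- exact: kder_addZ.
- by rewrite Es // mulr0 addr0.
- move=> j; rewrite mem_rcons inE => /predU1P[->|js].
    by rewrite Ek mulr1 subrr.
  by rewrite lower_rcons // Es // mulr0 addr0; apply: Dj.
Qed.

(* A derivation in the kernel of the rectangular matrix [D_i (x_j)] kills [F]. *)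
Lemma alg_indep_le d (g : 'I_d -> L) (F : L -> Prop) d' (y : 'I_d' -> L) :
  (forall z, F z -> cl (fun z => exists i, z = g i) z) ->
  (forall i, F (y i)) -> (forall P, ev y P = 0 -> P = 0) -> (d' <= d)%N.
Proof.
move=> Fg Fy ind; rewrite leqNgt; apply/negP => lt_d.
pose D i := proj1_sig (constructive_indefinite_description _ (alg_indep_dual ind i)).
have kD i : kder (D i) by rewrite /D; case: constructive_indefinite_description => ? [].
have Dy i j : D i (y j) = (i == j)%:R.
  by rewrite /D; case: constructive_indefinite_description => ? [].
pose A := \matrix_(i < d', j < d) D i (g j).
have : kermx A != 0.
  by rewrite kermx_eq0 /row_free neq_ltn (leq_ltn_trans (rank_leq_col A)).
move/rowV0Pn => [c /sub_kermxP cA c0]; case/eqP: c0; apply/rowP => j; rewrite mxE.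
have := Fg _ (Fy j) (fun z => \sum_i c 0 i * D i z) (kder_lin _ _ kD).
rewrite (bigD1 j) //= big1 ?Dy ?eqxx ?mulr1 ?addr0 => [->//|i ij]; last first.
  by rewrite Dy (negbTE ij) mulr0.
move=> z [i ->]; have /rowP/(_ i) := cA; rewrite !mxE => cAi; rewrite -[RHS]cAi.
by apply: eq_bigr => l _; rewrite mxE.
Qed.

End Greedy.
End CharacteristicZero.
End DifferentialClosure.

(** * The closure in a difference-differential field *)

Section DifferentialFields.
Variables (m n : nat) (K L : dsFieldType m n) (iota : {rmorphism K -> L}).
Implicit Types (S T : L -> Prop) (D : L -> L).
Local Notation cl := (cl iota).
Local Notation kder := (kder iota).

Lemma cl_subfield S : is_subfield (cl S).
Proof.
split=> [|x y Sx Sy D kD D0|x y Sx Sy D kD D0].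
- by rewrite -(rmorph1 iota); apply: cl_iota.
- by rewrite (kderB kD) // (Sx D kD D0) (Sy D kD D0) subrr.
- by rewrite (kderM kD) // (Sx D kD D0) (kderV kD) ?(Sy D kD D0) // mul0r mulr0 addr0.
Qed.

Lemma adjoin_cl S x : adjoin iota S x -> cl S x.
Proof.
by apply; [exact: cl_subfield | exact: cl_iota | move=> y; exact: cl_in].
Qed.

Section Stability.
Hypothesis ext : ds_extension iota.

Lemma ext_der i c : der i (iota c) = iota (der i c).
Proof. by case: ext => ->. Qed.

Lemma ext_aut j c : aut j (iota c) = iota (aut j c).
Proof. by case: ext => _ ->. Qed.

Lemma ext_autV j c : autV j (iota c) = iota (autV j c).
Proof. by apply: (can_inj (autK j)); rewrite autVK ext_aut autVK. Qed.

Lemma derD i (x y : L) : der i (x + y) = der i x + der i y.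
Proof. exact: raddfD. Qed.

Lemma der0 i : der i (0 : L) = 0.
Proof. exact: raddf0. Qed.

Lemma autD j (x y : L) : aut j (x + y) = aut j x + aut j y.
Proof. exact: rmorphD. Qed.

Lemma autM j (x y : L) : aut j (x * y) = aut j x * aut j y.
Proof. exact: rmorphM. Qed.

Lemma aut0 j : aut j (0 : L) = 0.
Proof. exact: rmorph0. Qed.

Lemma autVD j (x y : L) : autV j (x + y) = autV j x + autV j y.
Proof. by apply: (can_inj (autK j)); rewrite autD !autVK. Qed.

Lemma autVM j (x y : L) : autV j (x * y) = autV j x * autV j y.
Proof. by apply: (can_inj (autK j)); rewrite autM !autVK. Qed.

Lemma autV0 j : autV j (0 : L) = 0.
Proof. by apply: (can_inj (autK j)); rewrite autVK aut0. Qed.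

(* The commutator of a derivation over [K] with [der i] is again one. *)
Lemma cl_der i S T x :
  (forall y, S y -> cl T y /\ cl T (der i y)) -> cl S x -> cl T (der i x).
Proof.
move=> ST clx D kD D0; pose E y := D (der i y) - der i (D y).
have kE : kder E.
  split=> [a b|a b|c]; rewrite /E.
  - by rewrite derD !(kderD kD) // derD; ring.
  - by rewrite derM (kderD kD) // !(kderM kD) // derD !derM; ring.
  - by rewrite ext_der !(kder_iota kD) // der0 subrr.
have E0 : E x = 0.
  by apply: clx => // y /ST[Ty Tdy]; rewrite /E (Ty D) // (Tdy D) // der0 subrr.
have Tx : cl T x by apply: cl_trans clx => y /ST[].
have Dx := Tx D kD D0.
by move: E0; rewrite /E Dx der0 subr0.
Qed.

Lemma cl_aut j S T x :
  (forall y, S y -> cl T (aut j y)) -> cl S x -> cl T (aut j x).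
Proof.
move=> ST clx D kD D0; apply: (can_inj (autVK j)); rewrite autV0.
apply: (clx (fun y => autV j (D (aut j y)))) => [|y /ST Ty]; last first.
  by rewrite (Ty D) // autV0.
split=> [a b|a b|c].
- by rewrite autD (kderD kD) // autVD.
- by rewrite autM (kderM kD) // autVD !autVM !autK.
- by rewrite ext_aut (kder_iota kD) // autV0.
Qed.

Lemma cl_autV j S T x :
  (forall y, S y -> cl T (autV j y)) -> cl S x -> cl T (autV j x).
Proof.
move=> ST clx D kD D0; apply: (can_inj (autK j)); rewrite aut0.
apply: (clx (fun y => aut j (D (autV j y)))) => [|y /ST Ty]; last first.
  by rewrite (Ty D) // aut0.
split=> [a b|a b|c].
- by rewrite autVD (kderD kD) // autD.
- by rewrite autVM (kderM kD) // autD !autM !autVK.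
- by rewrite ext_autV (kder_iota kD) // aut0.
Qed.

End Stability.

Section Greedy.
Variables (I : eqType) (lt : rel I) (x : I -> L).
Hypotheses (lt_irr : irreflexive lt) (lt_trans : transitive lt).
Hypothesis char0 : forall k, k.+1%:R != 0 :> L.

(** [F] may be anything between the family and its closure; it is taken to be [adjoin] for the
    dimension polynomial and [cl] itself when generators are compared. *)
Lemma greedy_trdeg s (F : L -> Prop) : pairwise lt s ->
  (forall i, i \in s -> F (x i)) ->
  (forall z, F z -> cl (fun z => exists2 i, i \in s & z = x i) z) ->
  is_trdeg iota F (size [seq i <- s | indep_at iota lt x s i]).
Proof.
move=> pw Fs sF; set G := filter _ s.
have uG : uniq G.
  by apply: filter_uniq; apply: (pairwise_uniq lt_irr).
pose g i := tnth (in_tuple G) i.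
have gG i : g i \in G by apply: mem_tnth.
have gP i : g i \in s /\ indep_at iota lt x s (g i).
  by have := gG i; rewrite mem_filter => /andP[].
have g_inj : injective g by apply/tuple_uniqP.
split.
  exists (fun i => x (g i)); split=> [i|q f f_inj].
    by apply: Fs; case: (gP i).
  move=> P P0; apply: (dual_ev_eq0 char0 _ P0) => i; have [gs gi] := gP (f i).
  have [D [kD Di Dj]] := greedy_dual lt_irr lt_trans pw gs gi; exists D; split=> // j.
  have [<-//|ij] := eqVneq i j; have [? ?] := gP (f j).
  by apply: Dj => //; rewrite (inj_eq g_inj) (inj_eq f_inj) eq_sym.
move=> d' y Fy /(_ _ id (@inj_id _)) ind.
apply: (alg_indep_le char0 (g := x \o g) (F := F) _ Fy ind) => z /sF.
apply: cl_trans => _ [i is_ ->].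
have := greedy_span (iota := iota) (x := x) lt_irr lt_trans pw is_;
  apply: cl_sub => _ [j [js ij _ ->]].
have jG : j \in in_tuple G; first by rewrite mem_filter ij.
by have /tnthP[l ->] := jG; exists l.
Qed.

End Greedy.
End DifferentialFields.

(** * Counting outside an upset *)

Section ExponentVectors.
Local Open Scope nat_scope.
Implicit Types (u v w g h : seq nat) (gs : seq (seq nat)).

Definition vle u v := all2 leq u v.
Definition vadd u v := [seq t.1 + t.2 | t <- zip u v].
Definition vsub u v := [seq t.1 - t.2 | t <- zip u v].

Definition upset N (U : seq nat -> Prop) : Prop :=
  forall u v, size u = N -> size v = N -> vle u v -> U u -> U v.

Lemma vle_refl u : vle u u.
Proof. by elim: u => //= c u ->; rewrite leqnn. Qed.

(* Dickson's lemma: the slices [v |-> c :: v] of an upset increase with [c], and their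
   union is finitely generated by induction, hence reached by one of them. *)
Lemma upset_fg N (U : seq nat -> Prop) : upset N U ->
  exists gs, all (fun g => size g == N) gs /\
    forall v, size v = N -> (U v <-> has (fun g => vle g v) gs).
Proof.
elim: N U => [|N IHN] U upU.
  case: (classic (U [::])) => U0.
    by exists [:: [::]]; split=> // v /size0nil ->.
  by exists [::]; split=> // v /size0nil ->.
have slice c : upset N (fun v => U (c :: v)).
  move=> u v su sv uv; apply: upU; rewrite /= ?su ?sv //.
  by rewrite leqnn.
have [gs [gsN gsU]] : exists gs, all (fun g => size g == N) gs /\
    forall v, size v = N -> ((exists c, U (c :: v)) <-> has (fun g => vle g v) gs).
  by apply: IHN => u v su sv uv [c Uc]; exists c; apply: slice uv Uc.
have [C gsC] : exists C, forall g, g \in gs -> U (C :: g).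
  have : forall g, g \in gs -> exists c, U (c :: g).
    move=> g ggs; apply/gsU; first by apply/eqP; exact: (allP gsN).
    by apply/hasP; exists g => //; exact: vle_refl.
  elim: (gs) gsN => [|g l IHl] /=; first by exists 0.
  move=> /andP[/eqP sg sl] ex; have [|C HC] := IHl sl.
    by move=> h hl; apply: ex; rewrite inE hl orbT.
  have [c Uc] := ex g (mem_head _ _); exists (maxn c C) => h.
  rewrite inE => /predU1P[->|hl].
    by apply: upU Uc; rewrite /= ?sg // leq_maxl vle_refl.
  have sh : size h = N by apply/eqP; exact: (allP sl).
  by apply: upU (HC _ hl); rewrite /= ?sh // leq_maxr vle_refl.
(* [hs] collects generators of the slices below height [c], each put at its own height. Slice [C] is
   already the union of all slices, so [C.+1] of them suffice. *)
have fin c : exists hs, all (fun g => size g == N.+1) hs /\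
    forall d v, size v = N -> has (fun g => vle g (d :: v)) hs <->
      exists c', [/\ c' <= d, c' < c & U (c' :: v)].
  elim: c => [|c [hs [hsN hsU]]].
    by exists [::]; split=> // d v sv; split=> // -[c' []].
  have [ls [lsN lsU]] := IHN _ (slice c).
  exists ([seq c :: g | g <- ls] ++ hs); split.
    rewrite all_cat hsN andbT all_map; apply: sub_all lsN => g /eqP /= ->.
    by rewrite eqxx.
  move=> d v sv; rewrite has_cat has_map; split.
    case/orP => [/hasP[g gl /= /andP[cd gv]]|/hsU-/(_ sv)[c' [c'd c'c Uc']]].
      by exists c; split=> //; apply/lsU => //; apply/hasP; exists g.
    by exists c'; split=> //; apply: ltnW.
  move=> [c' [c'd +]]; rewrite ltnS leq_eqVlt => /predU1P[E|c'c] Uc'; last first.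
    by apply/orP; right; apply/hsU => //; exists c'.
  rewrite E in c'd Uc'; apply/orP; left; have /hasP[g gl gv] := (lsU v sv).1 Uc'.
  by apply/hasP; exists g => //=; rewrite c'd.
have [hs [hsN hsU]] := fin C.+1; exists hs; split=> // -[//|d v] [sv].
split=> [Ud|/hsU-/(_ sv)[c' [c'd _]]]; last first.
  by apply: upU; rewrite /= ?sv // c'd vle_refl.
apply/hsU => //; case: (leqP C d) => Cd; last by exists d; split=> //; apply: ltnW.
exists C; split=> //; have /hasP[g ggs gv] : has (fun g => vle g v) gs.
  by apply/gsU => //; exists d.
have sg : size g = N by apply/eqP; exact: (allP gsN).
by apply: slice gv (gsC _ ggs).
Qed.

Section Blocks.
Variable q : nat.
Implicit Types (l : seq 'I_q) (r : 'I_q -> nat).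

Fixpoint vdeg l w (i : 'I_q) : nat :=
  match l, w with
  | b :: l', c :: w' => (b == i) * c + vdeg l' w' i
  | _, _ => 0
  end.

Fixpoint vecs l r : seq (seq nat) :=
  match l with
  | [::] => if [forall i, r i == 0] then [:: [::]] else [::]
  | b :: l' =>
      [seq c :: w | c <- index_iota 0 (r b).+1, w <- vecs l' (fun i =>
        r i - (b == i) * c)]
  end.

Lemma vecs_cons b l r : vecs (b :: l) r =
  [seq c :: w | c <- index_iota 0 (r b).+1, w <- vecs l (fun i => r i - (b == i) * c)].
Proof. by []. Qed.

Lemma mem_vecs l r w :
  (w \in vecs l r) = (size w == size l) && [forall i, vdeg l w i == r i].
Proof.
elim: l r w => [|b l IHl] r w; last rewrite vecs_cons.
  rewrite /=; have [/forallP r0|/negP nr0] := boolP [forall i, r i == 0].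
    case: w => [|c w]; rewrite inE //=; apply/esym/forallP => i.
    by rewrite eq_sym r0.
  case: w => [|c w]; rewrite in_nil //=; apply/esym/negP => /forallP H.
  by apply: nr0; apply/forallP => i; rewrite eq_sym.
apply/allpairsPdep/idP => [[c [w' [+ + ->]]]|].
  rewrite mem_index_iota IHl /= eqSS ltnS => cr /andP[-> /forallP H] /=.
  apply/forallP => i; rewrite (eqP (H i)); case: (eqVneq b i) => [<-|_]; lia.
case: w => [//|c w] /=; rewrite eqSS => /andP[sw /forallP H].
have Hi i : (b == i) * c + vdeg l w i = r i by apply/eqP.
exists c, w; split=> //.
  by rewrite mem_index_iota /=; have := Hi b; rewrite eqxx; lia.
by rewrite IHl sw; apply/forallP => i; rewrite -(Hi i) addKn.
Qed.

Lemma vecsP l r w :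
  reflect (size w = size l /\ forall i, vdeg l w i = r i) (w \in vecs l r).
Proof.
rewrite mem_vecs; apply: (iffP andP) => -[/eqP sw H]; split=> //.
  by move=> i; apply/eqP/(forallP H).
by apply/forallP => i; apply/eqP.
Qed.

Lemma vecs_uniq l r : uniq (vecs l r).
Proof.
elim: l r => [|b l IHl] r; first by rewrite /=; case: ifP.
rewrite vecs_cons.
apply: allpairs_uniq_dep => [|c _|]; [exact: iota_uniq | exact: IHl |].
by move=> [c w] [c' w'] _ _ /= [-> ->].
Qed.

(** The number of [k]-tuples of naturals with sum [r]; the empty tuple is split off because [k - 1]
    would be truncated. *)
Definition nvec k (r : nat) :=
  if k is k'.+1 then 'C(r + k', k') else nat_of_bool (r == 0).

Lemma sum_nvec k (r : nat) : \sum_(0 <= c < r.+1) nvec k (r - c) = nvec k.+1 r.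
Proof.
rewrite big_nat_rev /=; under eq_big_nat => c /andP[_ cr].
  rewrite add0n subSS subKn; last by rewrite -ltnS. over.
elim: r => [|r IHr].
  by rewrite big_nat1; case: k => [|k]; rewrite /= ?addn0 ?add0n ?bin0 ?binn.
rewrite big_nat_recr //= IHr; case: k {IHr} => [|k] /=; first by rewrite !bin0 addn0.
by rewrite !addnS !addSn [RHS]binS.
Qed.

Lemma size_vecs l r : size (vecs l r) = \prod_i nvec (count_mem i l) (r i).
Proof.
elim: l r => [|b l IHl] r; last rewrite vecs_cons.
  rewrite /=; case: (boolP [forall i, r i == 0]) => [/forallP r0|].
    by rewrite big1 // => i _; rewrite (eqP (r0 i)).
  rewrite negb_forall => /existsP[i ri].
  by rewrite (bigD1 i) //= (negbTE ri) mul0n.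
rewrite size_allpairs_dep sumnE big_map.
under eq_bigr => c _.
  rewrite IHl (bigD1 b) //= eqxx mul1n.
  under eq_bigr => i ib do rewrite eq_sym (negbTE ib) mul0n subn0.
  over.
rewrite -big_distrl /= sum_nvec [RHS](bigD1 b) //= eqxx add1n; congr (_ * _).
by apply: eq_bigr => i ib; rewrite eq_sym (negbTE ib) add0n.
Qed.

Lemma vdeg_add l u v i : size u = size l -> size v = size l ->
  vdeg l (vadd u v) i = vdeg l u i + vdeg l v i.
Proof.
by elim: l u v => [|b l IHl] [|c u] [|d v] //= [su] [sv]; rewrite IHl //; lia.
Qed.

Lemma size_vadd u v N : size u = N -> size v = N -> size (vadd u v) = N.
Proof. by move=> su sv; rewrite size_map size_zip su sv minnn. Qed.

Lemma size_vsub u v N : size u = N -> size v = N -> size (vsub u v) = N.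
Proof. by move=> su sv; rewrite size_map size_zip su sv minnn. Qed.

Lemma vadd_inj g N u v : size g = N -> size u = N -> size v = N ->
  vadd u g = vadd v g -> u = v.
Proof.
elim: N g u v => [|N IHN] [|a g] [|c u] [|d v] //= [sg] [su] [sv].
by move=> [/addIn-> /(IHN _ _ _ sg su sv)->].
Qed.

Lemma vsubK g w : vle g w -> vadd (vsub w g) g = w.
Proof.
elim: g w => [|c g IHg] [|d w] //= /andP[cd /IHg gw].
by congr (_ :: _); first exact: subnK.
Qed.

Lemma vle_addl u g : size g = size u -> vle g (vadd u g).
Proof. by elim: g u => [|c g IHg] [|d u] //= [/IHg]; rewrite leq_addl. Qed.

Lemma vle_sub h g w : size h = size w -> size g = size w ->
  vle h (vadd w g) = vle (vsub h g) w.
Proof.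
by elim: w g h => [|c w IHw] [|d g] [|e h] //= [sh] [sg]; have := IHw _ _ sh sg;
rewrite /vle /= => ->; rewrite leq_subLR addnC.
Qed.

Lemma vecs_above l g r : size g = size l -> (forall i, vdeg l g i <= r i) ->
  perm_eq [seq w <- vecs l r | vle g w]
    [seq vadd w g | w <- vecs l (fun i => r i - vdeg l g i)].
Proof.
move=> sg gr; apply: uniq_perm; first exact/filter_uniq/vecs_uniq.
  rewrite map_inj_in_uniq ?vecs_uniq // => u v /vecsP[su _] /vecsP[sv _].
  exact: (vadd_inj sg).
move=> w; rewrite mem_filter;
  apply/andP/mapP => [[gw /vecsP[sw dw]]|[u /vecsP[su du] ->]].
  exists (vsub w g); last by rewrite vsubK.
  have ss := size_vsub sw sg; apply/vecsP; split=> // i.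
  by rewrite -(dw i) -{2}(vsubK gw) vdeg_add // addnK.
split; first by rewrite vle_addl ?su.
apply/vecsP; split=> [|i]; first exact: size_vadd.
by rewrite vdeg_add // du subnK.
Qed.

(* Inclusion-exclusion over the generators, with [t.2] the degree of a join and
   [t.1] its sign. *)
Lemma count_vecs l gs : (forall i, 0 < count_mem i l) ->
  all (fun g => size g == size l) gs ->
  exists (s : seq (int * {ffun 'I_q -> nat})) (r0 : nat),
    (\sum_(t <- s) t.1 = (gs == [::])%:Z)%R /\
    forall r, (forall i, r0 <= r i) ->
      ((count (fun w => ~~ has (fun g => vle g w) gs) (vecs l r))%:Z =
        \sum_(t <- s) t.1 *
          (\prod_i 'C(r i - t.2 i + (count_mem i l).-1, (count_mem i l).-1))%N%:Z)%R.
Proof.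
move=> l_gt0; have [N] := ubnP (size gs); elim: N gs => // N IHN [|g gs] sN.
  move=> _; exists [:: (1%R, [ffun=> 0])], 0; rewrite big_seq1; split=> // r _.
  rewrite big_seq1 mul1r; congr Posz; rewrite count_predT size_vecs.
  by apply: eq_bigr => i _; rewrite ffunE subn0; case: (count_mem i l) (l_gt0 i).
move=> /= /andP[/eqP sg sgs].
have [s1 [r1 [e1 c1]]] := IHN gs sN sgs.
(* [w + g] lies above [h] exactly when [w] lies above the truncated difference [h - g]. So the
   vectors above [g] that avoid [gs] are a translate of the complement of an upset with as many
   generators as [gs]. *)
have sgs' : all (fun g => size g == size l) [seq vsub h g | h <- gs].
  rewrite all_map; apply: sub_all sgs => h /eqP sh /=.
  by apply/eqP; apply: size_vsub.
have [|s2 [r2 [e2 c2]]] := IHN _ _ sgs'; first by rewrite size_map.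
pose f (t : int * {ffun 'I_q -> nat}) : int * {ffun 'I_q -> nat} :=
  ((- t.1)%R, [ffun i => vdeg l g i + t.2 i]).
exists (s1 ++ [seq f t | t <- s2]).
exists (r1 + r2 + \sum_i vdeg l g i); split.
  (* Both inductive sums are 1 or both are 0, according to whether [gs] is empty; once [g] is
     present they cancel. *)
  rewrite big_cat /= big_map /= sumrN e1 e2.
  by case: gs {sN sgs sgs' c1 c2 e1 e2} => //=; rewrite subrr.
move=> r rr; have gr i : vdeg l g i + (r1 + r2) <= r i.
  by apply: leq_trans (rr i); rewrite addnC leq_add2l (bigD1 i) //= leq_addr.
rewrite big_cat /= big_map /= -c1; last by move=> i; move: (gr i); lia.
under [in RHS]eq_bigr => t _ do rewrite mulNr.
rewrite sumrN; under [in RHS]eq_bigr => t _.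
  under eq_bigr => i _ do rewrite ffunE subnDA.
  over.
rewrite /= -(c2 (fun i => r i - vdeg l g i)%N); last first.
  by move=> i; move: (gr i); lia.
set A := fun w => has (fun h => vle h w) gs.
have <- : count (fun w => ~~ A w) [seq w <- vecs l r | vle g w] =
    count (fun w => ~~ has (fun h => vle h w) [seq vsub h g | h <- gs])
      (vecs l (fun i => r i - vdeg l g i)).
  have /seq.permP -> : perm_eq [seq w <- vecs l r | vle g w]
      [seq vadd w g | w <- vecs l (fun i => r i - vdeg l g i)].
    by apply: vecs_above => // i; move: (gr i); lia.
  rewrite count_map; apply: eq_in_count => w /vecsP[sw _] /=.
  rewrite /A has_map; congr (~~ _); apply: eq_in_has => h hg /=.
  by apply: vle_sub; rewrite ?sw //; apply/eqP; exact: (allP sgs).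
have := count_predC (vle g) [seq w <- vecs l r | ~~ A w].
rewrite size_filter !count_filter => <-; rewrite PoszD addrAC -[LHS]add0r.
congr (_ + _)%R.
  apply/esym/eqP; rewrite subr_eq0; apply/eqP; congr Posz.
  by apply: eq_count => w /=; rewrite andbC.
by congr Posz; apply: eq_count => w /=; rewrite negb_or.
Qed.

End Blocks.
End ExponentVectors.

(** * Binomial expansions *)

Section BinomialExpansion.

(* The coordinates of [binomial(t - g + b, b)] in the basis [binomial(t + k, k)]. *)
Fixpoint scoef (g b k : nat) : int :=
  if g is g'.+1 then scoef g' b k - scoef g' b k.+1 else (k == b)%:Z.

Lemma scoef_gt g b k : (b < k)%N -> scoef g b k = 0.
Proof.
elim: g k => [|g IHg] k bk /=; first by rewrite gtn_eqF.
by rewrite !IHg ?subrr // ltnW.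
Qed.

Lemma scoef_top g b : scoef g b b = 1.
Proof. by elim: g => [|g IHg] /=; rewrite ?eqxx // IHg scoef_gt. Qed.

(** Pascal's rule in the form [C(t - 1 + k, k) = C(t + k, k) - C(t + k - 1, k - 1)] explains the
    recursion of [scoef]; [g <= r] keeps the subtraction exact. *)
Lemma scoef_sum g b r : (g <= r)%N ->
  'C(r - g + b, b)%:Z = \sum_(k < b.+1) scoef g b k * 'C(r + k, k)%:Z.
Proof.
elim: g r => [|g IHg] r gr.
  rewrite big_ord_recr /= eqxx mul1r subn0 big1 ?add0r // => i _.
  by rewrite (ltn_eqF (ltn_ord i)) mul0r.
case: r gr => // r gr; rewrite subSS IHg //=.
under [RHS]eq_bigr => k _ do rewrite mulrBl.
rewrite sumrB [X in _ - X]big_ord_recr /= (scoef_gt _ (ltnSn b)) mul0r addr0.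
rewrite big_ord_recl [in RHS]big_ord_recl /= !bin0 -addrA; congr (_ + _).
rewrite -sumrB; apply: eq_bigr => k _; rewrite /bump /= add1n -mulrBr.
congr (_ * _); rewrite !addnS !addSn [X in _ = X%:Z - _]binS PoszD; ring.
Qed.

Variables (q : nat) (b : 'I_q -> nat).

Lemma prod_sum_dffun (R : comPzSemiRingType) (F : forall i : 'I_q, nat -> R) :
  \prod_i \sum_(k < (b i).+1) F i k =
  \sum_(e : {dffun forall i : 'I_q, 'I_(b i).+1}) \prod_i F i (e i).
Proof.
under eq_bigr => i _.
  under eq_bigr => k _ do rewrite -(ffunE (fun k : 'I_(b i).+1 => F i k)).
  rewrite (big_tag (T_ := fun i => 'I_(b i).+1) (fun i => [ffun k : 'I_(b i).+1 =>
    F i k])).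
  over.
rewrite bigA_distr_big_dep -(@big_fprod _ _ _ _ _ _ (fun i => 'I_(b i).+1)).
rewrite (reindex _ (onW_bij _ (@fprod_of_dffun_bij _ (fun i => 'I_(b i).+1)))) /=.
apply: eq_bigr => e _; apply: eq_bigr => i _.
by rewrite ffunE /fprod_of_dffun fprodE.
Qed.

Lemma binX_eval (i : 'I_q) k (r : 'I_q -> nat) :
  (binX i k).@[fun i => (r i)%:R] = 'C(r i + k, k)%:R.
Proof.
rewrite /binX mevalZ rmorph_prod /=.
under eq_bigr => j _ do rewrite mevalD mevalXU -mpolyC_nat mevalC -natrD.
apply: (@mulfI _ k`!%:R); first by rewrite pnatr_eq0 -lt0n fact_gt0.
rewrite mulrA divff ?mul1r; last by rewrite pnatr_eq0 -lt0n fact_gt0.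
rewrite -natrM mulnC bin_ffact -natr_prod; congr (_%:R).
elim: k => [|k IHk]; first by rewrite big_geq.
by rewrite big_nat_recr //= IHk addnS ffactnS mulnC.
Qed.

Lemma binom_expansion_eval a (r : 'I_q -> nat) :
  (binom_expansion b a).@[fun i => (r i)%:R] =
  (\sum_(e : {dffun forall i : 'I_q, 'I_(b i).+1})
     a [multinom (e i : nat) | i < q] * (\prod_i 'C(r i + e i, e i))%N%:Z)%:~R.
Proof.
rewrite /binom_expansion raddf_sum /= rmorph_sum /=; apply: eq_bigr => e _.
rewrite mevalZ rmorph_prod /= rmorphM /=; congr (_ * _).
rewrite -[RHS]/((_)%:R) natr_prod; apply: eq_bigr => i _.
exact: binX_eval.
Qed.

Definition shift_coef (s : seq (int * {ffun 'I_q -> nat})) (e : 'X_{1..q}) : int :=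
  \sum_(t <- s) t.1 * \prod_i scoef (t.2 i) (b i) (e i).

(** Shifts change only lower coordinates, so the top coefficient sees nothing but the signs of
    [count_vecs], whose sum tells whether an upset is empty. *)
Lemma shift_coef_top s : shift_coef s [multinom b i | i < q] = \sum_(t <- s) t.1.
Proof.
apply: eq_bigr => t _; rewrite big1 ?mulr1 // => i _.
by rewrite mnmE scoef_top.
Qed.

Lemma shift_coef_eval (s : seq (int * {ffun 'I_q -> nat})) (r : 'I_q -> nat) :
  (forall t, t \in s -> forall i, (t.2 i <= r i)%N) ->
  (binom_expansion b (shift_coef s)).@[fun i => (r i)%:R] =
  (\sum_(t <- s) t.1 * (\prod_i 'C(r i - t.2 i + b i, b i))%N%:Z)%:~R.
Proof.
move=> sr; rewrite binom_expansion_eval; congr (_%:~R).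
under eq_bigr => e _ do rewrite /shift_coef mulr_suml.
rewrite exchange_big /=; apply: eq_big_seq => t /sr tr.
under eq_bigr => e _ do rewrite -mulrA.
rewrite -mulr_sumr; congr (_ * _).
rewrite -[RHS]natz natr_prod.
under [RHS]eq_bigr => i _ do rewrite natz scoef_sum //.
rewrite (prod_sum_dffun (fun i k => scoef (t.2 i) (b i) k * 'C(r i + k, k)%:Z)).
apply: eq_bigr => e _; rewrite -[X in _ * X]natz natr_prod -big_split /=.
by apply: eq_bigr => i _; rewrite mnmE natz.
Qed.

Definition wt (w : 'I_q -> nat) (e : 'X_{1..q}) : nat := (\sum_i w i * e i)%N.

Lemma wt_le w e f : (f <= e)%MM -> (wt w f <= wt w e)%N.
Proof. by move/mnm_lepP => fe; apply: leq_sum => i _; rewrite leq_mul2l fe orbT. Qed.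

Lemma wt_eq w e f : (forall i, 0 < w i)%N -> (f <= e)%MM -> wt w f = wt w e -> f = e.
Proof.
move=> w0 /mnm_lepP fe E; apply/mnmP => i; apply/eqP; rewrite eqn_leq fe /=.
rewrite leqNgt; apply/negP => lt_fe; move/eqP: E; apply/negP; rewrite ltn_eqF //.
rewrite /wt (bigD1 i) //= [X in (_ < X)%N](bigD1 i) //= -addSn leq_add //.
  by rewrite ltn_mul2l w0.
by apply: leq_sum => j _; rewrite leq_mul2l fe orbT.
Qed.

(** Stronger than a leading monomial for one order: the whole support divides [e], which serves all
    weights at once. *)
Definition topmon (P : {mpoly rat[q]}) (e : 'X_{1..q}) (c : rat) : Prop :=
  (forall f, f \in msupp P -> (f <= e)%MM) /\ P@_e = c.

Lemma topmonM P Q e f c d :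
  topmon P e c -> topmon Q f d -> topmon (P * Q) (e + f)%MM (c * d).
Proof.
move=> [Pe Pc] [Qf Qd]; split.
  move=> g /msuppM_le /allpairsP[[u v] /= [/Pe /mnm_lepP ue /Qf /mnm_lepP vf ->]].
  by apply/mnm_lepP => i; rewrite !mnmDE leq_add.
have pe : (mdeg e < (mdeg (e + f)).+1)%N by rewrite mdegD ltnS leq_addr.
have pf : (mdeg f < (mdeg (e + f)).+1)%N by rewrite mdegD ltnS leq_addl.
rewrite mcoeffM (bigD1 (BMultinom pe, BMultinom pf)) //= Pc Qd big1 ?addr0 //.
move=> [u v] /= /andP[/eqP E ne].
have [->|Pu] := eqVneq P@_u 0; first by rewrite mul0r.
have [->|Qv] := eqVneq Q@_v 0; first by rewrite mulr0.
rewrite -mcoeff_msupp in Pu; rewrite -mcoeff_msupp in Qv.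
have /mnm_lepP ue := Pe _ Pu; have /mnm_lepP vf := Qf _ Qv.
case/eqP: ne; congr (_, _); apply/val_inj/mnmP => i /=.
  have /mnmP/(_ i) := E; rewrite !mnmDE; move: (ue i) (vf i); lia.
have /mnmP/(_ i) := E; rewrite !mnmDE; move: (ue i) (vf i); lia.
Qed.

Lemma topmon1 : topmon 1 0%MM 1.
Proof.
split; last by rewrite -mpolyC1 mcoeffC eqxx mulr1.
by move=> f; rewrite msupp1 inE => /eqP ->; apply: lepm_refl.
Qed.

Lemma topmonXD i j : topmon ('X_i + j%:R) U_(i)%MM 1.
Proof.
rewrite -mpolyC_nat; split.
  move=> f /msuppD_le; rewrite mem_cat => /orP[/mem_msuppXP <-|].
    exact: lepm_refl.
  by rewrite msuppC; case: ifP => //= _; rewrite inE => /eqP ->; apply/mnm_lepP => k;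
    rewrite mnm0E.
by rewrite mcoeffD mcoeffX mcoeffC eqxx mnm1_eq0 mulr0 addr0.
Qed.

Lemma topmon_binX i k : topmon (binX i k) (U_(i) *+ k)%MM (k`!%:R)^-1.
Proof.
have [T1 T2] : topmon (\prod_(1 <= j < k.+1) ('X_i + j%:R)) (U_(i) *+ k)%MM 1.
  elim: k => [|k IHk]; first by rewrite big_geq // mulm0n; exact: topmon1.
  rewrite big_nat_recr //= mulmSr.
  by have := topmonM IHk (topmonXD i k.+1); rewrite mulr1.
split=> [f /msuppZ_le/T1//|].
by rewrite mcoeffZ T2 mulr1.
Qed.

Definition fact_inv (e : 'X_{1..q}) : rat := \prod_i ((e i)`!%:R)^-1.

Lemma fact_inv_neq0 e : fact_inv e != 0.
Proof.
by apply/prodf_neq0 => i _; rewrite invr_eq0 pnatr_eq0 -lt0n fact_gt0.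
Qed.

Lemma topmon_prod (e : 'X_{1..q}) : topmon (\prod_i binX i (e i)) e (fact_inv e).
Proof.
have : topmon (\prod_i binX i (e i)) (\sum_i U_(i) *+ e i)%MM (fact_inv e).
  rewrite /fact_inv; elim/big_rec3: _ => [|i c f P _ Pf]; first exact: topmon1.
  by apply: topmonM => //; exact: topmon_binX.
by rewrite -multinomUE_id.
Qed.

Lemma msupp_binom_expansion a (f : 'X_{1..q}) : f \in msupp (binom_expansion b a) ->
  exists e, coef_supp b a e /\ (f <= e)%MM.
Proof.
move/msupp_sum_le/flatten_mapP => [e _ fe].
exists [multinom (e i : nat) | i < q]; split; last first.
  have := topmon_prod [multinom (e i : nat) | i < q].
  under eq_bigr => i _ do rewrite mnmE.
  by move=> [T _]; apply: T; apply: msuppZ_le fe.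
split=> [i|a0]; first by rewrite mnmE -ltnS.
by move: fe; rewrite a0 scale0r msupp0.
Qed.

(** A product indexed by [e] has only monomials dividing [e]. If [f] is among them and already has
    the maximal weight, positivity of the weights forces [f = e], so a single product
    contributes. *)
Lemma mcoeff_binom_expansion a (w : 'I_q -> nat) D : (forall i, (0 < w i)%N) ->
  (forall e, coef_supp b a e -> (wt w e <= D)%N) ->
  forall f : 'X_{1..q}, (forall i, (f i <= b i)%N) -> wt w f = D ->
  (binom_expansion b a)@_f = (a f)%:~R * fact_inv f.
Proof.
move=> w0 aD f fb fD; rewrite /binom_expansion raddf_sum /=.
pose g : {dffun forall i : 'I_q, 'I_(b i).+1} := [ffun i => inord (f i)].
have gf : [multinom (g i : nat) | i < q] = f.
  by apply/mnmP => i; rewrite mnmE ffunE inordK // ltnS.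
have T (e : {dffun forall i : 'I_q,
  'I_(b i).+1}) : topmon (\prod_(i < q) binX i (e i)) [multinom (e i : nat) | i < q]
    (fact_inv [multinom (e i : nat) | i < q]).
  have := topmon_prod [multinom (e i : nat) | i < q].
  by under eq_bigr => i _ do rewrite mnmE.
rewrite (bigD1 g) //= [X in _ + X]big1 ?addr0.
  by rewrite mcoeffZ; have [_] := T g; rewrite gf => ->.
move=> e ne; rewrite mcoeffZ; set h := [multinom _ | _ < q].
have [->|ah] := eqVneq (a h) 0; first by rewrite mul0r.
have hs : coef_supp b a h.
  by split=> [i|/eqP]; [rewrite mnmE -ltnS | rewrite (negbTE ah)].
have [P0|] := eqVneq (\prod_(i < q) binX i (e i))@_f 0.
  by rewrite P0 mulr0.
rewrite -mcoeff_msupp => fP; have [Te _] := T e.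
have fh := Te _ fP; case/eqP: ne; apply/ffunP => i; apply/val_inj.
have E : f = h.
  by apply: (wt_eq w0 fh); apply/eqP; rewrite eqn_leq wt_le //= fD aD.
by rewrite ffunE /= E /h mnmE inord_val.
Qed.

End BinomialExpansion.

(** * Growth and leading parts of polynomials *)

Section PolynomialGrowth.

Lemma nonpos_lead (F : {poly rat}) D u0 : (size F <= D.+1)%N ->
  (forall u : nat, (u0 <= u)%N -> F.[u%:R] <= 0) -> F`_D <= 0.
Proof.
move=> sF F0; rewrite leNgt; apply/negP => aD.
case: D sF aD => [|D] sF aD.
  have := F0 u0 (leqnn _); rewrite (size1_polyC sF) hornerC leNgt.
  by rewrite aD.
pose S := \sum_(i < D.+1) `|F`_i|.
have S0 : 0 <= S by apply: sumr_ge0.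
(* [S] bounds the lower coefficients; beyond [S] divided by the top coefficient the top term wins.
   The successor also makes [u] at least 1. *)
pose u := maxn u0 (Num.bound (S / F`_D.+1)).+1.
have uu : (u0 <= u)%N by rewrite leq_maxl.
have u1 : 1 <= u%:R :> rat by rewrite ler1n /u leq_max orbT.
have Su : S < F`_D.+1 * u%:R.
  rewrite mulrC -ltr_pdivrMr //; apply: lt_le_trans (archi_boundP _) _.
    by rewrite divr_ge0 // ltW.
  by rewrite ler_nat /u leq_max leqnSn orbT.
have := F0 u uu; rewrite leNgt => /negP; apply.
rewrite (horner_coef_wide _ sF) big_ord_recr /=.
apply: (@lt_le_trans _ _ ((F`_D.+1 * u%:R - S) * u%:R ^+ D)).
  by rewrite mulr_gt0 ?subr_gt0 // exprn_gt0 // (lt_le_trans ltr01).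
rewrite mulrBl -mulrA -exprS addrC lerD2l /S mulr_suml -sumrN.
apply: ler_sum => i _; rewrite lerNl.
apply: (@le_trans _ _ (`|F`_i| * u%:R ^+ i)).
  rewrite -mulNr ler_wpM2r ?exprn_ge0 ?(le_trans ler01) //.
  by rewrite -normrN ler_norm.
by rewrite ler_wpM2l // ler_weXn2l // -ltnS.
Qed.

(** Only an upper bound on the degree: [a] may vanish, so products need no case distinction. *)
Definition hasdeg (F : {poly rat}) (d : nat) (a : rat) : Prop :=
  (size F <= d.+1)%N /\ F`_d = a.

Lemma hasdegM F G d e a b : hasdeg F d a -> hasdeg G e b -> hasdeg (F * G) (d + e) (a *
  b).
Proof.
move=> [sF Fa] [sG Gb]; split.
  apply: leq_trans (size_polyMleq _ _) _; move: sF sG; lia.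
have dde : (d < (d + e).+1)%N by rewrite ltnS leq_addr.
rewrite coefM (bigD1 (Ordinal dde)) //= addKn Fa Gb big1 ?addr0 // => i ne.
have [id|di|E] := ltngtP i d.
- by rewrite [G`__]nth_default ?mulr0 //; apply: leq_trans sG _; lia.
- by rewrite nth_default ?mul0r //; apply: leq_trans sF _; lia.
- by case/eqP: ne; apply/val_inj.
Qed.

Lemma hasdegX F d a k : hasdeg F d a -> hasdeg (F ^+ k) (d * k) (a ^+ k).
Proof.
move=> HF; elim: k => [|k IHk].
  by rewrite muln0 !expr0; split; rewrite ?size_poly1 ?coef1.
by rewrite !exprS mulnS; apply: hasdegM.
Qed.

Variable q : nat.
Implicit Types (P Q : {mpoly rat[q]}) (w x c : 'I_q -> nat).

Definition wpart w D P : {mpoly rat[q]} :=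
  \sum_(e <- msupp P | wt w e == D) P@_e *: 'X_[e].

Definition curve w c x (i : 'I_q) : {poly rat} := (x i)%:R *: 'X^(w i) + (c i)%:R%:P.

Definition along w c x P : {poly rat} :=
  \sum_(e <- msupp P) P@_e *: \prod_i curve w c x i ^+ e i.

Lemma along_horner w c x P (u : nat) :
  (along w c x P).[u%:R] = P.@[fun i => (x i * u ^ w i + c i)%:R].
Proof.
rewrite mevalE /along horner_sum; apply: eq_bigr => e _.
rewrite hornerZ horner_prod; congr (_ * _); apply: eq_bigr => i _.
by rewrite !hornerE natrD natrM natrX.
Qed.

(** Positive weights make the shifts [c] of lower order, so they disappear from the coefficient of
    [u^D]. *)
Lemma along_hasdeg w c x P D : (forall i, 0 < w i)%N ->
  (forall e, e \in msupp P -> wt w e <= D)%N ->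
  hasdeg (along w c x P) D (wpart w D P).@[fun i => (x i)%:R].
Proof.
move=> w0 PD; rewrite /wpart raddf_sum /=.
have cd i : hasdeg (curve w c x i) (w i) (x i)%:R.
  split.
    apply: leq_trans (size_polyD _ _) _; rewrite geq_max.
    rewrite (leq_trans (size_scale_leq _ _)) ?size_polyXn //=.
    by apply: leq_trans (size_polyC_leq1 _) _.
  by rewrite coefD coefZ coefXn eqxx mulr1 coefC gtn_eqF ?addr0.
have md (e : 'X_{1..q}) : hasdeg (\prod_i curve w c x i ^+ e i) (wt w e)
    (\prod_i (x i)%:R ^+ e i).
  rewrite /wt; elim/big_rec3: _ => [|i a d F _ IH].
    by split; rewrite ?size_poly1 ?coef1.
  by apply: hasdegM => //; apply: hasdegX.
split.
  apply: (leq_trans (size_sum _ _ _)); apply/bigmax_leqP_seq => e eP _.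
  apply: leq_trans (size_scale_leq _ _) _; apply: leq_trans (proj1 (md e)) _.
  by rewrite ltnS PD.
rewrite coef_sum big_mkcond [RHS]big_mkcond /= [RHS]big_seq [LHS]big_seq.
apply: eq_bigr => e eP; rewrite coefZ.
have [<-|ne] := eqVneq (wt w e) D; first by rewrite (proj2 (md e)) mevalZ mevalX.
rewrite nth_default ?mulr0 //; apply: leq_trans (proj1 (md e)) _.
by rewrite ltn_neqAle ne PD.
Qed.

Lemma wpart_le w D c r0 P Q x :
  (forall i, 0 < w i)%N -> (forall i, 0 < x i)%N ->
  (forall e, e \in msupp P -> wt w e <= D)%N ->
  (forall e, e \in msupp Q -> wt w e <= D)%N ->
  (forall r : 'I_q -> nat, (forall i, (r0 <= r i)%N) ->
    P.@[fun i => (r i)%:R] <= Q.@[fun i => (r i + c i)%:R]) ->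
  (wpart w D P).@[fun i => (x i)%:R] <= (wpart w D Q).@[fun i => (x i)%:R].
Proof.
move=> w0 x0 PD QD PQ; rewrite -subr_le0.
have [sP <-] := along_hasdeg (fun=> 0) x w0 PD.
have [sQ <-] := along_hasdeg c x w0 QD.
(* Starting at [r0.+1] makes [u] positive, so [x i * u ^ w i] is at least [u] and the assumed
   inequality applies. *)
rewrite -coefB; apply: (@nonpos_lead _ _ r0.+1).
  apply: leq_trans (size_polyD _ _) _.
  by rewrite geq_max size_polyN sP.
move=> u ru; rewrite hornerD hornerN subr_le0 !along_horner.
have ur i : (r0 <= x i * u ^ w i)%N.
  apply: (@leq_trans u); first exact: ltnW.
  apply: leq_trans (leq_pmull _ (x0 i)).
  by rewrite -{1}(expn1 u) leq_pexp2l // (leq_trans _ ru).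
have := PQ (fun i => x i * u ^ w i)%N ur; apply: le_trans; rewrite le_eqVlt.
by apply/orP; left; apply/eqP; apply: meval_eq => i; rewrite addn0.
Qed.

End PolynomialGrowth.

(** * Weights that realise the lexicographic orders *)

Section LexicographicWeights.
Local Open Scope nat_scope.
Variable B : nat.

Lemma base_recl q (E : 'I_q.+1 -> nat) :
  \sum_(k < q.+1) E k * B ^ (q - k) =
  E ord0 * B ^ q + \sum_(k < q) E (lift ord0 k) * B ^ (q.-1 - k).
Proof.
rewrite big_ord_recl /= subn0; congr (_ + _); apply: eq_bigr => k _.
by congr (_ * _ ^ _); rewrite /bump /=; lia.
Qed.

Lemma base_lt_expn q (E : 'I_q -> nat) : (forall k, E k < B) ->
  \sum_(k < q) E k * B ^ (q.-1 - k) < B ^ q.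
Proof.
elim: q E => [|q IHq] E EB; first by rewrite big_ord0.
rewrite base_recl expnS; have := IHq (fun k => E (lift ord0 k)) (fun k => EB _).
have := leq_mul (EB ord0) (leqnn (B ^ q)); rewrite mulSn.
by move: (\sum_(k < q) _) (B ^ q) => R X; lia.
Qed.

(** Exponents are digits in base [B]: the tail of the smaller vector is less than one unit at
    position [k]. *)
Lemma base_lt q (E F : 'I_q -> nat) (k : 'I_q) : (forall i, E i < B) ->
  (forall i : 'I_q, i < k -> E i = F i) -> E k < F k ->
  \sum_(i < q) E i * B ^ (q.-1 - i) < \sum_(i < q) F i * B ^ (q.-1 - i).
Proof.
elim: q E F k => [|q IHq] E F k EB EF Ek; first by case: k EF Ek.
rewrite !base_recl; case: (unliftP ord0 k) EF Ek => [k' ->|->] EF Ek.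
  rewrite (EF ord0) // ltn_add2l; apply: (IHq _ _ k') => // i ik.
  by apply: EF; rewrite /= /bump /= !add1n ltnS.
have := base_lt_expn (fun i => EB (lift ord0 i)); have := leq_mul Ek (leqnn (B ^ q)).
rewrite mulSn; move: (\sum_(k < q) _) (\sum_(k < q) _) (B ^ q) => R R' X; lia.
Qed.

Variable q : nat.

Definition lexw (s : 'S_q) (i : 'I_q) : nat := B ^ (q.-1 - (s^-1)%g i).

Lemma wt_lexw s (e : 'X_{1..q}) :
  wt (lexw s) e = \sum_(k < q) e (s k) * B ^ (q.-1 - k).
Proof.
rewrite /wt (reindex_inj (@perm_inj _ s)); apply: eq_bigr => k _.
by rewrite /lexw permK mulnC.
Qed.

Lemma lex_lt_wt s (e f : 'X_{1..q}) : (forall i, e i < B) ->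
  lex_lt s e f -> wt (lexw s) e < wt (lexw s) f.
Proof. by move=> eB [k [kl kk]]; rewrite !wt_lexw; apply: (base_lt (k := k)). Qed.

Lemma lex_lt_total s (e f : 'X_{1..q}) : e <> f -> lex_lt s e f \/ lex_lt s f e.
Proof.
move=> ef; have [i0 ne0] : exists i, e (s i) != f (s i).
  apply/existsP; rewrite -negb_forall; apply/negP => /forallP H; apply: ef.
  by apply/mnmP => i; have := H ((s^-1)%g i); rewrite permKV => /eqP.
have [k kne kmin] :=
  @arg_minnP _ i0 (fun i => e (s i) != f (s i)) (fun i : 'I_q => i : nat) ne0.
have eqlt (l : 'I_q) : l < k -> e (s l) = f (s l).
  by move=> lk; apply/eqP; apply: contraLR lk => nl; rewrite -leqNgt kmin.
case: (ltngtP (e (s k)) (f (s k))) => [lt|gt|E]; last by rewrite E eqxx in kne.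
  by left; exists k.
by right; exists k; split=> // l /eqlt.
Qed.

Lemma wt_lexw_inj s (e f : 'X_{1..q}) : (forall i, e i < B) -> (forall i, f i < B) ->
  wt (lexw s) e = wt (lexw s) f -> e = f.
Proof.
move=> eB fB E; apply: NNPP => /(lex_lt_total s)[] /lex_lt_wt; rewrite E ltnn.
  by move=> /(_ eB).
by move=> /(_ fB).
Qed.

End LexicographicWeights.

(** * Invariance of the leading coefficients *)

Section LeadingParts.
Variable q : nat.
Implicit Types P Q : {mpoly rat[q]}.

Lemma exp_lt_msize P e i : e \in msupp P -> (e i < msize P)%N.
Proof.
move/msize_mdeg_lt; apply: leq_ltn_trans.
by rewrite mdegE (bigD1 i) //= leq_addr.
Qed.

(* Kronecker's substitution [x_i = u ^ (B ^ i)] separates the monomials of [P]. *)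
Lemma mpoly_nat_eq0 P :
  (forall x : 'I_q -> nat, (forall i, 0 < x i)%N -> P.@[fun i => (x i)%:R] = 0) -> P = 0.
Proof.
move=> P0; pose w := lexw (msize P).+1 (1%g : 'S_q).
pose F : {poly rat} := \sum_(e <- msupp P) P@_e *: 'X^(wt w e).
have Fu (u : nat) : (0 < u)%N -> F.[u%:R] = 0.
  move=> u0; rewrite -(P0 (fun i => u ^ w i)%N) => [|i]; last by rewrite expn_gt0 u0.
  rewrite mevalE /F horner_sum; apply: eq_bigr => e _; rewrite hornerZ hornerXn.
  congr (_ * _); rewrite /wt expr_sum; apply: eq_bigr => i _.
  by rewrite natrX exprM.
have F0 : F = 0.
  apply/eqP/negPn/negP => nzF.
  have := max_poly_roots nzF (rs := [seq k.+1%:R | k <- iota 0 (size F)]).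
  rewrite size_map size_iota ltnn => /(_ _ _)/negP; apply=> //.
    by apply/allP => _ /mapP[k _ ->]; rewrite rootE Fu.
  by rewrite map_inj_uniq ?iota_uniq // => a b /eqP; rewrite eqr_nat => /eqP[].
apply/mpolyP => e; rewrite mcoeff0; apply/eqP/negPn/negP => Pe.
have eP : e \in msupp P by rewrite mcoeff_msupp.
have := congr1 (fun G : {poly rat} => G`_(wt w e)) F0.
rewrite coef0 coef_sum (bigD1_seq e) ?msupp_uniq //= coefZ coefXn eqxx mulr1.
rewrite big_seq_cond big1 ?addr0 => [/eqP|f /andP[fP fe]]; first by rewrite (negbTE Pe).
rewrite coefZ coefXn; case: eqP => [E|_]; last by rewrite mulr0.
case/eqP: fe; apply/esym/(wt_lexw_inj (B := (msize P).+1) (s := 1%g)) => // i.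
  by rewrite ltnS ltnW // exp_lt_msize.
by rewrite ltnS ltnW // exp_lt_msize.
Qed.

Lemma mcoeff_wpart w D P e : (wpart w D P)@_e = if wt w e == D then P@_e else 0.
Proof.
rewrite /wpart raddf_sum /= -big_filter.
have [eF|eF] := boolP (e \in [seq f <- msupp P | wt w f == D]).
  rewrite (bigD1_seq e) ?filter_uniq ?msupp_uniq //= mcoeffZ mcoeffX eqxx mulr1.
  rewrite big1 ?addr0 => [|f fe]; last by rewrite mcoeffZ mcoeffX (negbTE fe) mulr0.
  by move: eF; rewrite mem_filter => /andP[->].
rewrite big_seq big1 => [|f fF]; last first.
  rewrite mcoeffZ mcoeffX; case: eqP => [E|_]; last by rewrite mulr0.
  by rewrite -E fF in eF.
by move: eF; rewrite mem_filter; case: eqP => //= _ /memN_msupp_eq0.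
Qed.

Definition asymp_le P Q : Prop :=
  exists (r0 : nat) (c : 'I_q -> nat), forall r : 'I_q -> nat, (forall i,
    (r0 <= r i)%N) ->
    P.@[fun i => (r i)%:R] <= Q.@[fun i => (r i + c i)%:R].

Lemma asymp_lead w D P Q : asymp_le P Q -> asymp_le Q P ->
  (forall i, 0 < w i)%N ->
  (forall e, e \in msupp P -> wt w e <= D)%N ->
  (forall e, e \in msupp Q -> wt w e <= D)%N ->
  forall e, wt w e = D -> P@_e = Q@_e.
Proof.
move=> [r1 [c1 PQ]] [r2 [c2 QP]] w0 PD QD e eD.
suff /eqP : wpart w D P - wpart w D Q = 0.
  rewrite subr_eq0 => /eqP/(congr1 (mcoeff e)).
  by rewrite !mcoeff_wpart eD eqxx.
apply: mpoly_nat_eq0 => x x0; apply/eqP; rewrite mevalB subr_eq0 eq_le.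
by rewrite (wpart_le w0 x0 PD QD PQ) (wpart_le w0 x0 QD PD QP).
Qed.

Section Expansions.
Variables (b : 'I_q -> nat) (a a' : 'X_{1..q} -> int).
Let P := binom_expansion b a.
Let P' := binom_expansion b a'.
Hypotheses (le1 : asymp_le P P') (le2 : asymp_le P' P).

Lemma asymp_coef w D : (forall i, 0 < w i)%N ->
  (forall e, coef_supp b a e -> wt w e <= D)%N ->
  (forall e, coef_supp b a' e -> wt w e <= D)%N ->
  forall e : 'X_{1..q}, (forall i, e i <= b i)%N -> wt w e = D -> a e = a' e.
Proof.
move=> w0 aD a'D e eb eD.
have bnd (a0 : 'X_{1..q} -> int) : (forall e, coef_supp b a0 e -> wt w e <= D)%N ->
    forall f, f \in msupp (binom_expansion b a0) -> (wt w f <= D)%N.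
  by move=> a0D f /msupp_binom_expansion[g [/a0D gD /(wt_le w)/leq_trans]]; apply.
have := asymp_lead le1 le2 w0 (bnd _ aD) (bnd _ a'D) eD.
rewrite !(mcoeff_binom_expansion w0 _ eb eD) //.
by move=> /(mulIf (fact_inv_neq0 e))/intr_inj.
Qed.

(** [asymp_coef] asks for a common weight bound, and here only the support of [a] is bounded. If
    [a'] had an exponent heavier than [e], a heaviest one would bound both supports; its coefficient
    would be shared by [a], against the maximality of [e]. *)
Lemma asymp_coef_max w e : (forall i, 0 < w i)%N ->
  coef_supp b a e -> (forall f, coef_supp b a f -> wt w f <= wt w e)%N ->
  a e = a' e /\ forall f, coef_supp b a' f -> (wt w f <= wt w e)%N.
Proof.
move=> w0 [eb ae] emax.
suff a'max f : coef_supp b a' f -> (wt w f <= wt w e)%N.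
  by split=> //; apply: (asymp_coef w0 emax a'max eb).
(* Both supports lie in the box given by [b], so [N] bounds all weights and the climb to a heaviest
   exponent ends. *)
pose N := (\sum_i w i * b i)%N.
have aN (g : 'X_{1..q}) : (forall i, g i <= b i)%N -> (wt w g <= N)%N.
  by move=> gb; apply: leq_sum => i _; rewrite leq_mul2l gb orbT.
move=> fs; rewrite leqNgt; apply/negP; have [M] := ubnP (N - wt w f)%N.
elim: M f fs => // M IHM f fs fM ef.
have [[g [gs fg]]|no] :=
    classic (exists g, coef_supp b a' g /\ (wt w f < wt w g)%N).
  apply: (IHM g gs); last exact: ltn_trans fg.
  have := aN g (proj1 gs); move: fM fg; lia.
have [fb a'f] := fs.
have : a f = a' f.
  apply: (asymp_coef w0 _ _ fb (erefl _)) => g gs.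
    by apply: leq_trans (emax _ gs) _; apply: ltnW.
  by rewrite leqNgt; apply/negP => fg; apply: no; exists g.
move=> E; have : coef_supp b a f by split=> //; rewrite E.
by move=> /emax; rewrite leqNgt ef.
Qed.

(** The base exceeds every exponent in the box, so the weight orders the supports
    lexicographically. *)
Lemma lex_max_wt (a0 : 'X_{1..q} -> int) s e :
  coef_supp b a0 e ->
  (forall f, coef_supp b a0 f -> ~ lex_lt s e f) <->
  (forall f, coef_supp b a0 f ->
     wt (lexw (\sum_i b i).+1 s) f <= wt (lexw (\sum_i b i).+1 s) e)%N.
Proof.
have B (f : 'X_{1..q}) : coef_supp b a0 f -> forall i, (f i < (\sum_i b i).+1)%N.
  move=> [fb _] i; rewrite ltnS; apply: leq_trans (fb i) _.
  by rewrite (bigD1 i) //= leq_addr.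
move=> es; split=> H f fs.
  have [->//|/eqP fe] := eqVneq f e; case: (lex_lt_total s fe).
    by move=> /(lex_lt_wt (B _ fs))/ltnW.
  by move=> /(H _ fs).
by move=> /(lex_lt_wt (B _ es)); rewrite ltnNge H.
Qed.

Lemma lex_maximal_asymp e : lex_maximal (coef_supp b a) e ->
  a' e = a e /\ lex_maximal (coef_supp b a') e.
Proof.
move=> [es [s /(lex_max_wt s es) emax]].
have w0 i : (0 < lexw (\sum_i b i).+1 s i)%N by rewrite expn_gt0.
have [ae a'max] := asymp_coef_max w0 es emax; split=> //.
have es' : coef_supp b a' e by case: es => eb; rewrite ae.
by split=> //; exists s; apply/(lex_max_wt s es').
Qed.

End Expansions.

Lemma wt1 (e : 'X_{1..q}) : wt (fun=> 1%N) e = mdeg e.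
Proof. by rewrite /wt mdegE; apply: eq_bigr => i _; rewrite mul1n. Qed.

(** If [P] had the larger degree, that degree would bound both supports, and the leading coefficient
    of [P] would equal a coefficient of [Q] beyond its degree. *)
Lemma asymp_msize_le P Q : asymp_le P Q -> asymp_le Q P -> (msize P <= msize Q)%N.
Proof.
move=> PQ QP; rewrite leqNgt; apply/negP => QltP.
have nzP : P != 0 by rewrite -msize_poly_eq0 -lt0n (leq_trans _ QltP).
have eP : mlead P \in msupp P by rewrite mlead_supp.
have eD : wt (fun=> 1%N) (mlead P) = (msize P).-1 by rewrite wt1 -mlead_deg.
have := asymp_lead (w := fun=> 1%N) PQ QP _ _ _ eD => /(_ (fun=> isT)) H.
have : P@_(mlead P) = Q@_(mlead P).
  apply: H => f /msize_mdeg_lt; rewrite wt1; lia.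
rewrite [RHS]memN_msupp_eq0; first by move/eqP; rewrite mleadc_eq0 (negbTE nzP).
by apply: msize_mdeg_ge; move: eD; rewrite wt1 => ->; lia.
Qed.

Lemma asymp_top P Q (e : 'X_{1..q}) : asymp_le P Q -> asymp_le Q P ->
  (mdeg e).+1 = msize P -> P@_e = Q@_e.
Proof.
move=> PQ QP eP; have sPQ := asymp_msize_le PQ QP; have sQP := asymp_msize_le QP PQ.
apply: (asymp_lead (w := fun=> 1%N) (D := mdeg e) PQ QP) => //; last exact: wt1.
  by move=> f /msize_mdeg_lt; rewrite wt1; lia.
by move=> f /msize_mdeg_lt; rewrite wt1; lia.
Qed.

End LeadingParts.

(** * Power products and their order *)

Section IteratedActions.
Variables (I T A : Type) (add : A -> A -> A) (act : I -> A -> T -> T).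
Hypothesis act_add : forall i a a' x, act i a (act i a' x) = act i (add a a') x.
Hypothesis act_comm : forall i j a a' x, act i a (act j a' x) = act j a' (act i a x).

(** Used twice: for the derivations with exponents in [nat] and for the automorphisms with exponents
    in [int]. *)
Definition actl (k : I -> A) (s : seq I) (x : T) : T :=
  foldr (fun i y => act i (k i) y) x s.

Lemma eq_actl k k' s x : k =1 k' -> actl k s x = actl k' s x.
Proof. by move=> kk; elim: s => //= i s ->; rewrite kk. Qed.

Lemma actl_comm (f : T -> T) k s x :
  (forall i a y, f (act i a y) = act i a (f y)) -> f (actl k s x) = actl k s (f x).
Proof. by move=> fC; elim: s => //= i s <-; rewrite fC. Qed.

Lemma actl_add k k' s x :
  actl k s (actl k' s x) = actl (fun i => add (k i) (k' i)) s x.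
Proof.
elim: s => //= i s IHs; rewrite -/(actl _ _ _) -(actl_comm (f := act i (k' i))) //.
by rewrite act_add IHs.
Qed.

End IteratedActions.

Lemma actl_single (I : eqType) (T A : Type) (act : I -> A -> T -> T) (a0 : A)
    (k : I -> A) v s x :
  (forall i y, act i a0 y = y) -> (forall i, i != v -> k i = a0) ->
  uniq s -> v \in s -> actl act k s x = act v (k v) x.
Proof.
move=> act0 k0; have triv s' : v \notin s' -> actl act k s' x = x.
  elim: s' => //= i s' IHs; rewrite inE negb_or => /andP[vi /IHs ->].
  by rewrite k0 ?act0 // eq_sym.
elim: s => //= i s IHs /andP[is_ us]; rewrite inE => /predU1P[E|vs].
  by rewrite -/(actl _ _ _ _) triv E.
by rewrite -/(actl _ _ _ _) IHs // k0 ?act0 //; apply: contraNneq is_ => ->.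
Qed.

Section PowerProducts.
Variables (m n : nat) (F : dsFieldType m n).
Implicit Types (x : F) (l : Lam m n).

Definition ladd l l' : Lam m n :=
  ([ffun i => (l.1 i + l'.1 i)%N], [ffun j => l.2 j + l'.2 j]).

Definition lder (v : 'I_m) : Lam m n := ([ffun i => (i == v : nat)], [ffun=> 0]).
Definition laut (t : {ffun 'I_n -> int}) : Lam m n := ([ffun=> 0%N], t).
Definition unitz (u : 'I_n) (z : int) : {ffun 'I_n -> int} :=
  [ffun j => if j == u then z else 0].

Lemma autzS j z x : aut j (autz j z x) = autz j (z + 1) x.
Proof.
case: z => [k|[|k]].
- by rewrite -PoszD addn1.
- by rewrite /= autVK.
- by rewrite [LHS]/= autVK NegzE [X in autz j X](_ : _ = Negz k) //; lia.
Qed.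

Lemma autzP j z x : autV j (autz j z x) = autz j (z - 1) x.
Proof. by rewrite -{1}(subrK 1 z) -autzS autK. Qed.

Lemma autz_add j z z' x : autz j z (autz j z' x) = autz j (z + z') x.
Proof.
case: z => k; elim: k => [|k IHk].
- by rewrite add0r.
- have -> : Posz k.+1 = Posz k + 1 by rewrite -PoszD addn1.
  by rewrite -autzS IHk autzS addrAC.
- by have := autzP j z' x; rewrite /= addrC => ->.
- have -> : Negz k.+1 = Negz k - 1 by lia.
  by rewrite -autzP IHk autzP addrAC.
Qed.

Lemma der_autVC i j x : der i (autV j x) = autV j (der i x).
Proof. by apply: (can_inj (autK j)); rewrite autVK -der_autC autVK. Qed.

Lemma aut_autVC i j x : aut i (autV j x) = autV j (aut i x).
Proof. by apply: (can_inj (autK j)); rewrite autVK -autC autVK. Qed.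

Lemma autVC i j x : autV i (autV j x) = autV j (autV i x).
Proof. by apply: (can_inj (autK j)); rewrite autVK aut_autVC autVK. Qed.

Lemma autz_comm (f : F -> F) j z x : (forall y, f (aut j y) = aut j (f y)) ->
  (forall y, f (autV j y) = autV j (f y)) -> f (autz j z x) = autz j z (f x).
Proof.
move=> fA fV; case: z => k; elim: k => [|k IHk] //.
- by rewrite /= fA; move: IHk => /= ->.
- by rewrite /= fV.
- by rewrite /= fV; move: IHk => /= ->.
Qed.

Lemma autzC i j z z' x : autz i z (autz j z' x) = autz j z' (autz i z x).
Proof.
apply: autz_comm => y; apply/esym; apply: autz_comm => w.
- exact: autC.
- exact: aut_autVC.
- by rewrite aut_autVC.
- exact: autVC.
Qed.

Lemma iter_derC i i' k k' x :
  iter k (der (s := F) i) (iter k' (der i') x) = iter k' (der i') (iter k (der i) x).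
Proof.
elim: k => //= k ->; elim: k' => //= k' IHk; by rewrite derC IHk.
Qed.

Lemma iter_der_autz i j k z x :
  autz j z (iter k (der (s := F) i) x) = iter k (der i) (autz j z x).
Proof.
elim: k => //= k <-; apply/esym/autz_comm => y; [exact: der_autC | exact: der_autVC].
Qed.

Definition dact := actl (fun i k => iter k (der (s := F) i)).
Definition aact := actl (@autz m n F).

Lemma lactE l x : lact l x = dact l.1 (enum 'I_m) (aact l.2 (enum 'I_n) x).
Proof. by []. Qed.

Lemma lact_add l l' x : lact l (lact l' x) = lact (ladd l l') x.
Proof.
rewrite !lactE /aact -(actl_comm (f := dact l'.1 (enum 'I_m))); last first.
  by move=> j z y; apply/esym/actl_comm => i k w; apply: iter_der_autz.
rewrite (@actl_add _ _ _ +%R); [|exact: autz_add|exact: autzC].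
rewrite /dact (@actl_add _ _ _ addn); last 2 first.
- by move=> i k k' y; rewrite iterD.
- by move=> *; apply: iter_derC.
rewrite /ladd /=; set y := actl _ _ _ x; set y' := actl _ _ _ x.
have -> : y = y' by apply: eq_actl => j; rewrite ffunE.
by apply: eq_actl => i; rewrite ffunE.
Qed.

Lemma lact_lder v x : lact (lder v) x = der v x.
Proof.
rewrite lactE /lder /= /dact /aact.
have -> : actl (autz (F:=F)) [ffun=> 0] (enum 'I_n) x = x.
  by elim: (enum _) => //= j s ->; rewrite ffunE.
rewrite (@actl_single _ _ _ _ 0%N _ v) ?enum_uniq ?mem_enum //;
  first by rewrite ffunE eqxx.
by move=> i iv; rewrite ffunE (negbTE iv).
Qed.

Lemma dact0 s x : dact [ffun=> 0%N] s x = x.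
Proof. by elim: s => //= j s; rewrite /dact => ->; rewrite ffunE. Qed.

Lemma lact_lautE t x : lact (laut t) x = aact t (enum 'I_n) x.
Proof. by rewrite lactE dact0. Qed.

Lemma lact_laut u z x : lact (laut (unitz u z)) x = autz u z x.
Proof.
rewrite lact_lautE /aact (@actl_single _ _ _ _ 0 _ u) ?enum_uniq ?mem_enum //.
  by rewrite ffunE eqxx.
by move=> i iv; rewrite ffunE (negbTE iv).
Qed.

Lemma der_lact v l x : der v (lact l x) = lact (ladd (lder v) l) x.
Proof. by rewrite -lact_add lact_lder. Qed.

End PowerProducts.

Arguments lder {m n} v.
Arguments laut {m n} t.
Arguments dact {m n F} k s x.
Arguments aact {m n F} k s x.

Section PowerProductClosure.
Variables (m n : nat) (K L : dsFieldType m n) (iota : {rmorphism K -> L}).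
Hypothesis ext : ds_extension iota.
Implicit Types (S T : L -> Prop).

(** The hypothesis speaks of the full power [z] only, so the induction runs through the set of
    images of [S], and [T] enters at the end. *)
Lemma cl_autz j z S T x :
  (forall y, S y -> cl iota T (autz j z y)) -> cl iota S x -> cl iota T (autz j z x).
Proof.
move=> ST Sx; apply: (cl_trans (S := fun y => exists2 w, S w & y = autz j z w)).
  by move=> _ [w Sw ->]; apply: ST.
case: z {ST} => k; elim: k => [|k IHk].
- by apply: cl_sub Sx => y Sy; exists y.
- apply: (cl_aut ext) IHk => _ [w Sw ->].
  by apply: cl_in; exists w.
- by apply: (cl_autV ext) Sx => w Sw; apply: cl_in; exists w.
- apply: (cl_autV ext) IHk => _ [w Sw ->].
  by apply: cl_in; exists w.
Qed.

Lemma cl_laut (t : {ffun 'I_n -> int}) S T x :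
  (forall y, S y -> cl iota T (lact (laut t) y)) -> cl iota S x ->
  cl iota T (lact (laut t) x).
Proof.
rewrite lact_lautE => ST; have {}ST y : S y -> cl iota T (aact t (enum 'I_n) y).
  by move/ST; rewrite lact_lautE.
move=> Sx; apply: (cl_trans (S := fun y => exists2 w, S w & y = aact t (enum 'I_n) w)).
  by move=> _ [w Sw ->]; apply: ST.
elim: (enum _) {ST} => [|j s IHs] /=; first by apply: cl_sub Sx => y Sy; exists y.
by apply: cl_autz IHs => _ [w Sw ->]; apply: cl_in; exists w.
Qed.

End PowerProductClosure.

Section LexicographicKeys.

Fixpoint lexi (u v : seq int) : bool :=
  match u, v with
  | a :: u', b :: v' => (a < b) || (a == b) && lexi u' v'
  | _, _ => false
  end.

Lemma lexi_irr : irreflexive lexi.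
Proof. by elim=> //= a u ->; rewrite ltxx andbF. Qed.

Lemma lexi_trans : transitive lexi.
Proof.
elim=> [|b v IH] [|a u] [|c w] //= /orP[ab|/andP[/eqP<- uv]] /orP[bc|/andP[/eqP<- vw]].
- by rewrite (lt_trans ab bc).
- by rewrite ab.
- by rewrite bc.
- by rewrite eqxx (IH _ _ uv vw) orbT.
Qed.

Lemma lexi_total u v : size u = size v -> u <> v -> lexi u v \/ lexi v u.
Proof.
elim: u v => [|a u IHu] [|b v] //= [suv] ne.
have [ab|ba|E] := ltgtP a b; [by left | by right |].
by apply: IHu => // uv; apply: ne; rewrite E uv.
Qed.

Definition addi (u v : seq int) : seq int := [seq t.1 + t.2 | t <- zip u v].

Lemma lexi_add c u v : size u = size c -> size v = size c ->
  lexi (addi c u) (addi c v) = lexi u v.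
Proof.
rewrite /addi; elim: c u v => [|d c IHc] [|a u] [|b v] //= [su] [sv].
by rewrite IHc // ltrD2l (inj_eq (addrI d)).
Qed.

End LexicographicKeys.

Section PowerProductOrder.
Variables (m n s : nat).
Implicit Types (l mu : Lam m n) (i j : 'I_s).

Lemma ord_sig_lder v l : ord_sig (ladd (lder v) l) = ord_sig l.
Proof. by apply: eq_bigr => u _; rewrite !ffunE add0r. Qed.

Lemma ord_sig_laut_le u z l :
  (ord_sig (ladd (laut (unitz u z)) l) <= ord_sig l + `|z|)%N.
Proof.
rewrite /ord_sig (bigD1 u) //= [X in (_ <= X + _)%N](bigD1 u) //=.
rewrite !ffunE eqxx.
under eq_bigr => j ju do rewrite !ffunE (negbTE ju) add0r.
by move: (\sum_(_ < _ | _) _)%N => S; lia.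
Qed.

Lemma ord_sig_laut u z l : 0 <= z * l.2 u ->
  ord_sig (ladd (laut (unitz u z)) l) = (ord_sig l + `|z|)%N.
Proof.
rewrite /ord_sig (bigD1 u) //= [X in _ -> _ = (X + _)%N](bigD1 u) //=.
rewrite !ffunE eqxx => zl.
under eq_bigr => j ju do rewrite !ffunE (negbTE ju) add0r.
have -> : `|(z + l.2 u)%R|%N = (`|z| + `|l.2 u|)%N by nia.
by move: (\sum_(_ < _ | _) _)%N => S; lia.
Qed.

Definition expo l : seq int :=
  [seq (l.1 v)%:Z | v <- enum 'I_m] ++ [seq l.2 u | u <- enum 'I_n].

Definition key (t : Lam m n * 'I_s) : seq int :=
  t.2%:Z :: (ord_sig t.1)%:Z :: expo t.1.

Definition ltk (t t' : Lam m n * 'I_s) : bool := lexi (key t) (key t').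

Lemma size_expo l : size (expo l) = (m + n)%N.
Proof. by rewrite size_cat (size_map _ (enum 'I_m)) (size_map _ (enum 'I_n))
  !size_enum_ord. Qed.

Lemma expo_add l l' : expo (ladd l l') = addi (expo l) (expo l').
Proof.
rewrite /expo /addi zip_cat ?size_map // map_cat; congr (_ ++ _).
  by elim: (enum _) => //= v q ->; rewrite ffunE PoszD.
by elim: (enum _) => //= v q ->; rewrite ffunE.
Qed.

Lemma ltk_irr : irreflexive ltk.
Proof. by move=> t; apply: lexi_irr. Qed.

Lemma ltk_trans : transitive ltk.
Proof. by move=> t t' t''; apply: lexi_trans. Qed.

Lemma key_inj : injective key.
Proof.
move=> [l i] [l' i'] [/val_inj -> _] /eqP.
rewrite eqseq_cat ?size_map // => /andP[/eqP/eq_in_map E1 /eqP/eq_in_map E2].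
congr (_, _); case: l l' E1 E2 => [k z] [k' z'] /= E1 E2; congr (_, _).
  by apply/ffunP => v; have [] := E1 v (mem_enum _ _).
by apply/ffunP => v; apply: E2; rewrite mem_enum.
Qed.

Lemma ltk_total t t' : t <> t' -> ltk t t' \/ ltk t' t.
Proof.
move=> ne; apply: lexi_total => [|/key_inj//].
by rewrite /= !size_expo.
Qed.

Lemma ltkE l i l' i' : ltk (l, i) (l', i') =
  (i < i')%N || (i == i') && ((ord_sig l < ord_sig l')%N ||
     (ord_sig l == ord_sig l') && lexi (expo l) (expo l')).
Proof. by []. Qed.

Lemma ltk_der v l i l' i' : ltk (l, i) (l', i') ->
  ltk (ladd (lder v) l, i) (ladd (lder v) l', i').
Proof. by rewrite !ltkE !ord_sig_lder !expo_add lexi_add ?size_expo. Qed.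

Lemma ltk_der_self v l i : ltk (l, i) (ladd (lder v) l, i).
Proof.
rewrite ltkE ltnn eqxx ord_sig_lder ltnn eqxx /= /expo.
have vm : v \in enum 'I_m by rewrite mem_enum.
elim: (enum 'I_m) vm => //= v' q IHq; rewrite !ffunE inE.
by case: (eqVneq v v') => /= [<-|vv'] => [|/IHq ->]; rewrite ?eqxx ?ltrDr ?orbT //; lia.
Qed.

(* [ord_sig] grows by exactly [`|z|] on the larger side and by at most [`|z|] on the
   smaller one, whatever its orthant. *)
Lemma ltk_aut u z l i l' i' : 0 <= z * l'.2 u -> ltk (l, i) (l', i') ->
  ltk (ladd (laut (unitz u z)) l, i) (ladd (laut (unitz u z)) l', i').
Proof.
move=> zl; rewrite !ltkE !expo_add lexi_add ?size_expo // (ord_sig_laut zl).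
have ab := ord_sig_laut_le u z l.
case/orP => [->//|/andP[-> /= H]]; apply/orP; right;
  case/orP: H => [bc|/andP[/eqP bc ->]].
  by rewrite (leq_ltn_trans ab) ?ltn_add2r.
by rewrite andbT orbC -leq_eqVlt -bc.
Qed.

Lemma sort_ltk (S : seq (Lam m n * 'I_s)) : uniq S ->
  exists S', perm_eq S' S /\ pairwise ltk S'.
Proof.
pose le t t' := (t == t') || ltk t t'.
have le_tot : total le.
  move=> t t'; rewrite /le; have [//|/eqP ne] := eqVneq t t'.
  by case: (ltk_total ne) => ->; rewrite ?orbT.
have le_tr : transitive le.
  move=> t t' t'' /orP[/eqP->//|a] /orP[/eqP<-|b]; rewrite /le ?a ?orbT //.
  by rewrite (ltk_trans a b) orbT.
move=> uS; exists (sort le S); have pS : perm_eq (sort le S) S by rewrite perm_sort.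
split=> //; have := sort_sorted le_tot S; rewrite (sorted_pairwise le_tr).
have := sort_uniq le S; rewrite uS; elim: (sort le S) => //= t q IHq.
move=> /andP[tq uq] /andP[/allP tle pq]; rewrite IHq // andbT.
apply/allP => t' tq'; have := tle _ tq'; rewrite /le => /orP[/eqP E|//].
by rewrite E tq' in tq.
Qed.

End PowerProductOrder.

(** * Dependent power products *)

Lemma ladd_inj m n (l : Lam m n) : injective (ladd l).
Proof.
move=> [k z] [k' z'] E; congr (_, _); apply/ffunP => v.
  by have /(congr1 (fun l : Lam m n => l.1 v)) := E; rewrite !ffunE => /addnI.
by have /(congr1 (fun l : Lam m n => l.2 v)) := E; rewrite !ffunE => /addrI.
Qed.

Section Leaders.
Variables (m n p : nat) (ms : 'I_p -> nat) (blk : 'I_m -> 'I_p).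
Hypothesis blkP : forall (v : 'I_m) (i : 'I_p),
  (\sum_(j < p | (j < i)%N) ms j <= v < \sum_(j < p | (j <= i)%N) ms j)%N = (blk v == i).
Variables (K L : dsFieldType m n) (iota : {rmorphism K -> L}).
Hypothesis ext : ds_extension iota.
Variables (s : nat) (eta : 'I_s -> L).
Implicit Types (l mu : Lam m n) (r : 'I_p.+1 -> nat) (j : 'I_s).

Lemma ord_blkE i l : ord_blk ms i l = (\sum_(v | blk v == i) l.1 v)%N.
Proof. by apply: eq_bigl => v; rewrite blkP. Qed.

Lemma ord_blk_lder i v l :
  ord_blk ms i (ladd (lder v) l) = ((blk v == i) + ord_blk ms i l)%N.
Proof.
rewrite !ord_blkE; under eq_bigr => w _ do rewrite !ffunE.
rewrite big_split /=; congr (_ + _)%N; rewrite big_mkcond (bigD1 v) //= eqxx.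
rewrite big1 ?addn0 => [|w wv]; first by case: ifP.
by rewrite (negbTE wv); case: ifP.
Qed.

Lemma ord_blk_laut i t l : ord_blk ms i (ladd (laut t) l) = ord_blk ms i l.
Proof. by rewrite !ord_blkE; apply: eq_bigr => w _; rewrite !ffunE. Qed.

Definition below r (t : Lam m n * 'I_s) (y : L) : Prop :=
  exists t', [/\ in_Lam ms r t'.1, ltk t' t & y = lact t'.1 (eta t'.2)].

(** [r] is part of the notion because an element smaller for [ltk] may lie outside [in_Lam ms r]. *)
Definition dep r l j : Prop := cl iota (below r (l, j)) (lact l (eta j)).

Lemma in_Lam_le r r' l : (forall i, r i <= r' i)%N -> in_Lam ms r l -> in_Lam ms r' l.
Proof.
by move=> rr [lb ls]; split=> [i|]; [apply: leq_trans (lb i) _ | apply: leq_trans ls _].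
Qed.

Lemma dep_le r r' l j : (forall i, r i <= r' i)%N -> dep r l j -> dep r' l j.
Proof.
move=> rr; apply: cl_sub => y [t [tr tl ->]]; exists t; split=> //.
exact: in_Lam_le tr.
Qed.

Lemma in_Lam_lder v r l : in_Lam ms r l ->
  in_Lam ms (fun i => r i + (i == lift ord_max (blk v)))%N (ladd (lder v) l).
Proof.
move=> [lb ls]; split=> [i|]; last by rewrite ord_sig_lder (leq_trans ls) // leq_addr.
by rewrite ord_blk_lder addnC leq_add // (inj_eq (@lift_inj _ _)) eq_sym.
Qed.

Lemma in_Lam_laut u z r l : (`|z| <= 1)%N -> in_Lam ms r l ->
  in_Lam ms (fun i => r i + (i == ord_max))%N (ladd (laut (unitz u z)) l).
Proof.
move=> z1 [lb ls]; split=> [i|];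
  first by rewrite ord_blk_laut (leq_trans (lb i)) // leq_addr.
by rewrite eqxx (leq_trans (ord_sig_laut_le _ _ _)) // leq_add.
Qed.

(** The commutator argument of [cl_der] involves both [y] and [der v y]; [ltk_der_self] keeps the
    former below the new leader. *)
Lemma dep_lder v r l j : dep r l j ->
  dep (fun i => r i + (i == lift ord_max (blk v)))%N (ladd (lder v) l) j.
Proof.
move=> d; rewrite /dep -der_lact; apply: (cl_der ext) d => y [[l' j'] [/= lr lt ->]].
split; last first.
  rewrite der_lact; apply: cl_in; exists (ladd (lder v) l', j'); split=> //=.
    exact: in_Lam_lder.
  exact: ltk_der.
apply: cl_in; exists (l', j'); split=> //=.
  by apply: in_Lam_le lr => i; apply: leq_addr.
by apply: ltk_trans lt _; apply: ltk_der_self.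
Qed.

(** The sign condition says that the step leads away from 0, as [ltk_aut] demands of the larger
    element. *)
Lemma dep_laut u z r l j : `|z|%N = 1%N -> 0 <= z * l.2 u -> dep r l j ->
  dep (fun i => r i + (i == ord_max))%N (ladd (laut (unitz u z)) l) j.
Proof.
move=> z1 zl; rewrite /dep -lact_add; apply: (cl_laut ext) => y [[l' j'] [/= lr lt ->]].
rewrite lact_add; apply: cl_in; exists (ladd (laut (unitz u z)) l', j'); split=> //=.
  by apply: in_Lam_laut; rewrite ?z1.
exact: ltk_aut.
Qed.

(* The orthants of [Z^n] are made disjoint by giving [0] the positive sign; the negative
   integers are then numbered from [-1]. *)
Definition sgn (b : bool) (k : nat) : int := if b then Negz k else Posz k.
Definition sgz_neg (z : int) : bool := if z is Negz _ then true else false.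
Definition mag (z : int) : nat := match z with Posz k => k | Negz k => k end.

Lemma sgnK z : sgn (sgz_neg z) (mag z) = z. Proof. by case: z. Qed.

Lemma sgn_inj b b' k k' : sgn b k = sgn b' k' -> b = b' /\ k = k'.
Proof. by case: b b' => [] [] //= [->]. Qed.

Lemma abs_sgn b k : `|sgn b k|%N = (k + b)%N.
Proof. by case: b => /=; lia. Qed.

Lemma abs_sgnD b k z : (`|(sgn b k + z)%R| <= k.+1 + `|z|)%N.
Proof. by case: b => /=; lia. Qed.

Lemma sgz_neg_sgnD b k z : (`|z| < k)%N -> sgz_neg (sgn b k + z) = b.
Proof.
move=> zk; have : (0 <= sgn b k + z) = ~~ b by case: b => /=; lia.
by case: (sgn b k + z) => c; case: b {zk}.
Qed.

(* A vector lists [p + 1] slack variables, the exponents of the derivations and the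
   exponents of the automorphisms; [blocks] gives the degree which each of them raises. *)
Definition blocks : seq 'I_p.+1 :=
  enum 'I_p.+1 ++ [seq lift ord_max (blk v) | v <- enum 'I_m] ++ nseq n ord_max.

Implicit Types (e : {ffun 'I_n -> bool}) (w : seq nat).

Definition decode e w : Lam m n :=
  ([ffun v : 'I_m => nth 0%N w (p.+1 + v)], [ffun u : 'I_n =>
    sgn (e u) (nth 0%N w (p.+1 + m + u))]).

(** Since negative integers are numbered from -1, [ord_sig] of a decoded vector exceeds the sum of
    its last [n] entries by this amount. *)
Definition negs e : nat := (\sum_u e u)%N.

Lemma negs_le e : (negs e <= n)%N.
Proof.
rewrite -[X in (_ <= X)%N]card_ord -sum1_card; apply: leq_sum => u _; exact: leq_b1.
Qed.

Lemma size_blocks : size blocks = (p.+1 + m + n)%N.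
Proof. by rewrite !size_cat (size_map _ (enum 'I_m)) !size_enum_ord size_nseq addnA. Qed.

Lemma nth_blocks_slack (i : 'I_p.+1) : nth ord_max blocks i = i.
Proof. by rewrite nth_cat size_enum_ord ltn_ord nth_ord_enum. Qed.

Lemma nth_blocks_der (v : 'I_m) : nth ord_max blocks (p.+1 + v) = lift ord_max (blk v).
Proof.
rewrite nth_cat size_enum_ord ltnNge leq_addr /= addKn nth_cat size_map size_enum_ord
  ltn_ord.
by rewrite (nth_map v) ?size_enum_ord // nth_ord_enum.
Qed.

Lemma nth_blocks_aut (u : 'I_n) : nth ord_max blocks (p.+1 + m + u) = ord_max.
Proof.
rewrite nth_cat size_enum_ord -addnA ltnNge leq_addr /= addKn nth_cat size_map
  size_enum_ord.
by rewrite ltnNge leq_addr /= addKn nth_nseq ltn_ord.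
Qed.

Lemma vdegE q (b : seq 'I_q) d w i : size w = size b ->
  vdeg b w i = (\sum_(t < size b) (nth d b t == i) * nth 0 w t)%N.
Proof.
elim: b w => [|c b IHb] [|x w] //=; first by rewrite big_ord0.
by move=> [sw]; rewrite big_ord_recl /= IHb.
Qed.

Lemma vdeg_blocks w (i : 'I_p.+1) : size w = size blocks ->
  vdeg blocks w i = (nth 0 w i + \sum_(v < m) (lift ord_max (blk v) == i) * nth 0 w
    (p.+1 + v)
    + (i == ord_max) * \sum_(u < n) nth 0 w (p.+1 + m + u))%N.
Proof.
move=> sw; rewrite (vdegE ord_max) // size_blocks big_split_ord big_split_ord /=.
congr (_ + _ + _)%N.
- rewrite (bigD1 i) //= nth_blocks_slack eqxx mul1n big1 ?addn0 // => i' ii'.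
  by rewrite nth_blocks_slack (negbTE ii').
- by apply: eq_bigr => v _; rewrite nth_blocks_der.
- rewrite big_distrr /=; apply: eq_bigr => u _.
  by rewrite nth_blocks_aut eq_sym.
Qed.

Lemma lift_max_eq (i : 'I_p) : (lift ord_max i == ord_max) = false.
Proof. by rewrite eq_sym (negbTE (neq_lift _ _)). Qed.

Lemma vdeg_blk e w i : size w = size blocks ->
  vdeg blocks w (lift ord_max i) = (nth 0 w i + ord_blk ms i (decode e w))%N.
Proof.
move=> sw; rewrite vdeg_blocks // lift_max_eq /= addn0.
rewrite ord_blkE /= [in RHS]big_mkcond /=; congr (_ + _)%N.
  by rewrite /bump leqNgt ltn_ord.
apply: eq_bigr => v _; rewrite (inj_eq (@lift_inj _ _)) ffunE.
by case: eqP; rewrite ?mul1n.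
Qed.

Lemma vdeg_sig e w : size w = size blocks ->
  (vdeg blocks w ord_max + negs e = nth 0 w p + ord_sig (decode e w))%N.
Proof.
move=> sw; rewrite vdeg_blocks // big1 ?addn0 => [|v _]; last first.
  by rewrite lift_max_eq.
rewrite eqxx mul1n -addnA -big_split /=; congr (_ + _)%N.
by apply: eq_bigr => u _; rewrite ffunE abs_sgn.
Qed.

Definition ddeg e w (i : 'I_p.+1) : nat := (vdeg blocks w i + (i == ord_max) * negs e)%N.

Lemma decode_in_Lam e w : size w = size blocks -> in_Lam ms (ddeg e w) (decode e w).
Proof.
move=> sw; split=> [i|].
  by rewrite /ddeg (vdeg_blk e) // lift_max_eq addn0 leq_addl.
by rewrite /ddeg eqxx mul1n vdeg_sig // leq_addl.
Qed.

Definition lowered e r (i : 'I_p.+1) : nat := (r i - (i == ord_max) * negs e)%N.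

(** As [negs e] is at most [n], the bound on [r ord_max] keeps the subtraction in [lowered]
    exact. *)
Lemma ddeg_vecs e r w : (n <= r ord_max)%N -> w \in vecs blocks (lowered e r) ->
  forall i, ddeg e w i = r i.
Proof.
move=> rn /vecsP[_ dw] i; rewrite /ddeg dw /lowered.
by case: eqP => [->|_]; have := negs_le e; lia.
Qed.

(** The slacks fill the orders of [l] up to [r], turning the inequalities of [in_Lam] into the exact
    degrees that [vecs] enumerates. *)
Definition encode r l : seq nat :=
  [seq oapp (fun i => r i' - ord_blk ms i l) (r ord_max - ord_sig l) (unlift ord_max i')
     | i' : 'I_p.+1 <- enum 'I_p.+1]%N ++
  [seq l.1 v | v <- enum 'I_m] ++ [seq mag (l.2 u) | u <- enum 'I_n].

Lemma size_encode r l : size (encode r l) = size blocks.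
Proof.
by rewrite size_blocks !size_cat !(size_map _ (enum _)) !size_enum_ord addnA.
Qed.

Lemma encodeK r l : decode [ffun u => sgz_neg (l.2 u)] (encode r l) = l.
Proof.
case: l => k z; rewrite /decode /encode /=; congr (_, _); apply/ffunP => v;
  rewrite !ffunE.
  rewrite nth_cat (size_map _ (enum _)) size_enum_ord ltnNge leq_addr /= addKn.
  rewrite nth_cat (size_map _ (enum _)) size_enum_ord ltn_ord.
  by rewrite (nth_map v) ?size_enum_ord // nth_ord_enum.
rewrite nth_cat (size_map _ (enum _)) size_enum_ord -addnA ltnNge leq_addr /= addKn.
rewrite nth_cat (size_map _ (enum _)) size_enum_ord ltnNge leq_addr /= addKn.
by rewrite (nth_map v) ?size_enum_ord // nth_ord_enum sgnK.
Qed.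

Lemma nth_encode r l (i' : 'I_p.+1) : nth 0%N (encode r l) i' =
  (oapp (fun i => r i' - ord_blk ms i l) (r ord_max - ord_sig l) (unlift ord_max i'))%N.
Proof.
rewrite nth_cat (size_map _ (enum _)) size_enum_ord ltn_ord.
by rewrite (nth_map i') ?size_enum_ord // nth_ord_enum.
Qed.

Lemma encode_vecs r l : in_Lam ms r l ->
  encode r l \in vecs blocks (lowered [ffun u => sgz_neg (l.2 u)] r).
Proof.
move=> [lb ls]; have sw := size_encode r l; apply/vecsP; split=> // i'.
rewrite /lowered; case: (unliftP ord_max i') => [i ->|->].
  rewrite (vdeg_blk [ffun u => sgz_neg (l.2 u)]) // encodeK.
  have := nth_encode r l (lift ord_max i); rewrite liftK lift_max => -> /=.
  by rewrite lift_max_eq subn0 subnK // lb.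
have := vdeg_sig [ffun u => sgz_neg (l.2 u)] sw; rewrite encodeK.
have := nth_encode r l ord_max; rewrite unlift_none /= => ->.
by rewrite eqxx mul1n subnK // => <-; rewrite addnK.
Qed.

(** Signs are recovered because the orthants are disjoint, slacks because the degrees are
    prescribed. *)
Lemma decode_inj e e' r w w' : (n <= r ord_max)%N ->
  w \in vecs blocks (lowered e r) -> w' \in vecs blocks (lowered e' r) ->
  decode e w = decode e' w' -> e = e' /\ w = w'.
Proof.
move=> rn wv wv' E; have dw := ddeg_vecs rn wv; have dw' := ddeg_vecs rn wv'.
have [[sw _] [sw' _]] := (elimT (vecsP _ _ _) wv, elimT (vecsP _ _ _) wv').
have E1 (v : 'I_m) : nth 0%N w (p.+1 + v) = nth 0%N w' (p.+1 + v).
  by have /(congr1 (fun l : Lam m n => l.1 v)) := E; rewrite !ffunE.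
have E2 (u : 'I_n) : e u = e' u /\
    nth 0%N w (p.+1 + m + u) = nth 0%N w' (p.+1 + m + u).
  have /(congr1 (fun l : Lam m n => l.2 u)) := E; rewrite !ffunE; exact: sgn_inj.
have ee : e = e' by apply/ffunP => u; case: (E2 u).
split=> //; apply: (@eq_from_nth _ 0%N) => [|t]; first by rewrite sw sw'.
rewrite sw size_blocks => tN.
have [tp|pt] := ltnP t p.+1; last first.
  have [tm|mt] := ltnP t (p.+1 + m).
    have vm : (t - p.+1 < m)%N by lia.
    by have := E1 (Ordinal vm); rewrite /= subnKC.
  have un : (t - (p.+1 + m) < n)%N by lia.
  by have [_] := E2 (Ordinal un); rewrite /= subnKC.
have := dw (Ordinal tp); rewrite -dw' /ddeg ee => /addIn.
rewrite !vdeg_blocks // => H; apply/(@addIn (\sum_(v < m)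
  (lift ord_max (blk v) == Ordinal tp) * nth 0 w (p.+1 + v)
  + (Ordinal tp == ord_max) * \sum_(u < n) nth 0 w (p.+1 + m + u))%N).
rewrite addnA H -addnA; congr (_ + (_ + _ * _))%N.
  by apply: eq_bigr => v _; rewrite E1.
by apply: eq_bigr => u _; case: (E2 u).
Qed.

Lemma nth_incr w t t' : nth 0%N (incr_nth w t) t' = ((t == t') + nth 0%N w t')%N.
Proof. exact: nth_incr_nth. Qed.

Lemma ddeg_incr e w t : size w = size blocks -> (t < size blocks)%N ->
  forall i, ddeg e (incr_nth w t) i = (ddeg e w i + (nth ord_max blocks t == i))%N.
Proof.
move=> sw tN i; rewrite /ddeg addnAC; congr (_ + _)%N.
rewrite (vdegE ord_max) ?size_incr_nth ?sw ?tN // (vdegE ord_max) //.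
rewrite (bigD1 (Ordinal tN)) // [X in (X + _)%N](bigD1 (Ordinal tN)) //=.
rewrite nth_incr eqxx mulnDr muln1 -addnA [RHS]addnC; congr (_ + (_ + _))%N.
apply: eq_bigr => t' tt'; rewrite nth_incr [X in (X + _)%N](_ : _ = 0)%N //.
by rewrite eq_sym -(inj_eq val_inj) /= in tt'; rewrite (negbTE tt').
Qed.

Definition ldep e j w : Prop := dep (ddeg e w) (decode e w) j.

(** A slack raises [r] alone; the other coordinates raise [r] and [l] together, by a derivation or
    an automorphism. *)
Lemma ldep_incr e j w t : size w = size blocks -> (t < size blocks)%N ->
  ldep e j w -> ldep e j (incr_nth w t).
Proof.
move=> sw tN; rewrite /ldep => d; have dd := ddeg_incr e sw tN.
move: tN; rewrite size_blocks => tN.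
have [tp|pt] := ltnP t p.+1.
  have -> : decode e (incr_nth w t) = decode e w.
    congr (_, _); apply/ffunP => v; rewrite !ffunE nth_incr (_ : (t == _) = false) //.
      by apply/eqP; lia.
    by apply/eqP; lia.
  by apply: dep_le d => i; rewrite dd leq_addr.
have [tm|mt] := ltnP t (p.+1 + m).
  have vm : (t - p.+1 < m)%N by lia.
  have [v0 tE] : exists v0 : 'I_m, t = (p.+1 + v0)%N.
    by exists (Ordinal vm); rewrite /= subnKC.
  have -> : decode e (incr_nth w t) = ladd (lder v0) (decode e w).
    congr (_, _); apply/ffunP => v; rewrite !ffunE nth_incr.
      by rewrite tE eqn_add2l eq_sym.
    by rewrite add0r (_ : (t == _) = false) //; apply/eqP; lia.
  apply: dep_le (dep_lder (v := v0) d) => i.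
  by rewrite dd tE nth_blocks_der eq_sym.
have un : (t - (p.+1 + m) < n)%N by lia.
have [u0 tE] : exists u0 : 'I_n, t = (p.+1 + m + u0)%N.
  by exists (Ordinal un); rewrite /= subnKC.
(* The unit step away from 0 inside the orthant [e]. *)
pose z : int := if e u0 then -1 else 1.
have -> : decode e (incr_nth w t) = ladd (laut (unitz u0 z)) (decode e w).
  congr (_, _); apply/ffunP => v; rewrite !ffunE nth_incr.
    by rewrite (_ : (t == _) = false) //; apply/eqP; have := ltn_ord v; lia.
  rewrite tE eqn_add2l (inj_eq val_inj) eq_sym /z.
  by case: eqP => [->|_]; rewrite ?add0r //; case: (e _) => /=; lia.
have z1 : `|z|%N = 1%N by rewrite /z; case: (e _).
have zl : 0 <= z * (decode e w).2 u0.
  by rewrite ffunE /z; case: (e _) => /=; lia.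
apply: dep_le (dep_laut z1 zl d) => i.
by rewrite dd tE nth_blocks_aut eq_sym.
Qed.

Lemma incr_cat (pre : seq nat) c u :
  incr_nth (pre ++ c :: u) (size pre) = pre ++ c.+1 :: u.
Proof. by elim: pre => //= x pre ->. Qed.

Lemma upset_incr N (U : seq nat -> Prop) :
  (forall w t, size w = N -> (t < N)%N -> U w -> U (incr_nth w t)) -> upset N U.
Proof.
move=> UI u v su sv; suff H : forall pre, (size pre + size u)%N = N ->
    size u = size v -> vle u v -> U (pre ++ u) -> U (pre ++ v).
  by apply: (H [::]); rewrite ?su ?sv.
elim: u v {su sv} => [|c u IHu] [|d v] // pre sN [suv] /= /andP[cd uv] Uc.
have {Uc} Ud : U (pre ++ d :: u).
  rewrite -(subnK cd); elim: (d - c)%N => // k IHk; rewrite addSn -incr_cat.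
  by apply: UI; rewrite ?size_cat //= -sN addnS ltnS leq_addr.
by rewrite -cat_rcons; apply: IHu; rewrite ?cat_rcons // size_rcons -sN addnS.
Qed.

Lemma ldep_upset e j : upset (size blocks) (ldep e j).
Proof. by apply: upset_incr => w t sw tN; apply: ldep_incr. Qed.

(** * Counting the independent power products *)

Section Counting.
Hypothesis char0 : forall k, k.+1%:R != 0 :> L.
Hypothesis blk_card : forall i : 'I_p, #|[pred v | blk v == i]| = ms i.

Definition Lams r : seq (Lam m n * 'I_s) :=
  [seq (decode t.2 w, t.1) | t <- enum {: 'I_s * {ffun 'I_n -> bool}},
                             w <- vecs blocks (lowered t.2 r)].

Lemma mem_Lams r t : (n <= r ord_max)%N -> t \in Lams r <-> in_Lam ms r t.1.
Proof.
move=> rn; split.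
  move=> /allpairsPdep[[j e] [w [_ wv ->]]] /=; have /vecsP[sw _] := wv.
  by apply: in_Lam_le (decode_in_Lam e sw) => i; rewrite (ddeg_vecs rn wv).
case: t => l j /= lr; apply/allpairsPdep.
exists (j, [ffun u => sgz_neg (l.2 u)]), (encode r l); split.
- by rewrite mem_enum.
- exact: encode_vecs.
- by rewrite encodeK.
Qed.

Lemma Lams_uniq r : (n <= r ord_max)%N -> uniq (Lams r).
Proof.
move=> rn; apply: allpairs_uniq_dep => [|t _|]; [exact: enum_uniq | exact: vecs_uniq |].
move=> _ _ /allpairsPdep[[j e] [w [_ wv ->]]] /allpairsPdep[[j' e'] [w' [_ wv' ->]]] /=.
move=> E; have /= jj := congr1 snd E; have /= := congr1 fst E.
by move/(decode_inj rn wv wv') => /= [ee ww]; subst.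
Qed.

Definition power_product (t : Lam m n * 'I_s) : L := lact t.1 (eta t.2).

Lemma indep_at_dep r S t : (n <= r ord_max)%N -> perm_eq S (Lams r) ->
  indep_at iota (@ltk m n s) power_product S t = boolp.asbool (~ dep r t.1 t.2).
Proof.
move=> rn SL; have low y : lower (@ltk m n s) power_product S t y <-> below r t y.
  split=> [[t' [t'S tt ->]]|[t' [t'r tt ->]]]; exists t'; split=> //.
    by apply/(mem_Lams _ rn); rewrite -(perm_mem SL).
  by rewrite (perm_mem SL); apply/(mem_Lams _ rn).
case: t low => l j low.
by apply/indep_atP/boolp.asboolP => H; apply: contra_not H; apply: cl_sub => y /low.
Qed.

Definition Ndim r : nat := size [seq t <- Lams r | boolp.asbool (~ dep r t.1 t.2)].

Lemma trdeg_Ndim r (F : L -> Prop) : (n <= r ord_max)%N ->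
  (forall y, Lam_eta ms eta r y -> F y) ->
  (forall z, F z -> cl iota (Lam_eta ms eta r) z) ->
  is_trdeg iota F (Ndim r).
Proof.
move=> rn etaF Fcl; have [S [SL pw]] := sort_ltk (Lams_uniq rn).
have -> : Ndim r = size [seq t <- S | indep_at iota (@ltk m n s) power_product S t].
  rewrite (eq_filter (fun t => indep_at_dep t rn SL)); apply/esym/perm_size.
  exact: perm_filter.
apply: (greedy_trdeg (@ltk_irr m n s) (@ltk_trans m n s) char0 pw).
  move=> [l j]; rewrite (perm_mem SL) => /(mem_Lams _ rn) lr.
  by apply: etaF; exists j, l.
move=> z /Fcl; apply: cl_sub => _ [j [l [lr ->]]]; exists (l, j) => //.
by rewrite (perm_mem SL); apply/(mem_Lams _ rn).
Qed.

Lemma trdeg_adjoin r : (n <= r ord_max)%N ->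
  is_trdeg iota (adjoin iota (Lam_eta ms eta r)) (Ndim r).
Proof.
move=> rn; apply: trdeg_Ndim => // [y yS F _ _|z]; first exact.
exact: adjoin_cl.
Qed.

Definition ldep_count (t : 'I_s * {ffun 'I_n -> bool}) r : nat :=
  count (fun w => boolp.asbool (~ ldep t.2 t.1 w)) (vecs blocks (lowered t.2 r)).

Lemma Ndim_sum r : (n <= r ord_max)%N ->
  Ndim r = (\sum_(t : 'I_s * {ffun 'I_n -> bool}) ldep_count t r)%N.
Proof.
move=> rn; rewrite /Ndim size_filter count_flatten -map_comp sumnE big_map big_enum /=.
apply: eq_bigr => t _; rewrite count_map; apply: eq_in_count => w wv /=.
have dw := ddeg_vecs rn wv.
by apply/boolp.asboolP/boolp.asboolP => H; apply: contra_not H; apply: dep_le => i;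
  rewrite dw.
Qed.

Lemma count_blocks (i' : 'I_p.+1) : count_mem i' blocks = (bounds ms n i').+1.
Proof.
rewrite !count_cat count_uniq_mem ?enum_uniq // mem_enum add1n; congr _.+1.
rewrite count_map count_nseq /bounds; case: (unliftP ord_max i') => [i ->|->] /=.
  rewrite eq_sym lift_max_eq mul0n addn0 -(blk_card i) cardE -size_filter.
  congr size; rewrite enumT; apply: eq_filter => v /=.
  by rewrite (inj_eq (@lift_inj _ _)).
rewrite eqxx mul1n (eq_count (a2 := pred0)) ?count_pred0 // => v /=.
by rewrite lift_max_eq.
Qed.

Definition never (t : 'I_s * {ffun 'I_n -> bool}) : bool :=
  boolp.asbool (forall w, size w = size blocks -> ~ ldep t.2 t.1 w).

Local Notation shifted r g := (\prod_i 'C(r i - g i + bounds ms n i, bounds ms n i))%N.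

Lemma ldep_count_poly t :
  exists (S : seq (int * {ffun 'I_p.+1 -> nat})) (r0 : nat),
    \sum_(x <- S) x.1 = (never t)%:Z /\
    forall r, (forall i, r0 <= r i)%N ->
      (ldep_count t r)%:Z = \sum_(x <- S) x.1 * (shifted r x.2)%:Z.
Proof.
case: t => j e; have [gs [gsN gsU]] := upset_fg (@ldep_upset e j).
have b0 i : (0 < count_mem i blocks)%N by rewrite count_blocks.
have [S [r0 [S1 S2]]] := count_vecs b0 gsN.
(* Vectors are counted in degree [lowered e r], so [negs e] joins the shift of the last
   coordinate. *)
pose f (x : int * {ffun 'I_p.+1 -> nat}) : int * {ffun 'I_p.+1 -> nat} :=
  (x.1, [ffun i => (i == ord_max) * negs e + x.2 i]%N).
exists [seq f x | x <- S], (r0 + negs e)%N; split.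
  rewrite big_map /= S1; congr (Posz (nat_of_bool _)).
  apply/eqP/boolp.asboolP => [gs0 w sw /gsU|nU]; first by rewrite gs0 => /(_ sw).
  case: gs gsN gsU {S1 S2} => // g gs /= /andP[/eqP sg _] /(_ g sg)[_].
  by rewrite vle_refl => /(_ isT)/(nU _ sg).
move=> r rr; rewrite /ldep_count.
have -> : count (fun w => boolp.asbool (~ ldep e j w)) (vecs blocks (lowered e r)) =
    count (fun w => ~~ has (fun g => vle g w) gs) (vecs blocks (lowered e r)).
  apply: eq_in_count => w /vecsP[sw _]; have U := gsU w sw.
  by apply/boolp.asboolP/negP => H; apply: contra_not H => /U.
rewrite S2 => [|i]; last by rewrite /lowered; have := rr i; case: eqP => _; lia.
rewrite big_map /=; apply: eq_bigr => x _; congr (_ * Posz _).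
by apply: eq_bigr => i _; rewrite ffunE subnDA count_blocks.
Qed.

Lemma Ndim_poly : exists (a : 'X_{1..p.+1} -> int) (r0 : nat),
  a [multinom bounds ms n i | i < p.+1] = \sum_t (never t)%:Z /\
  forall r, (forall i, r0 <= r i)%N ->
    (binom_expansion (bounds ms n) a).@[fun i => (r i)%:R] = (Ndim r)%:R.
Proof.
have [S [r0 [S1 S2]]] : exists (S : seq (int * {ffun 'I_p.+1 -> nat})) (r0 : nat),
    \sum_(x <- S) x.1 = \sum_t (never t)%:Z /\
    forall r, (forall i, r0 <= r i)%N ->
      (\sum_t ldep_count t r)%N%:Z = \sum_(x <- S) x.1 * (shifted r x.2)%:Z.
  elim: (index_enum _) => [|t q [S [r0 [S1 S2]]]].
    by exists [::], 0%N; split=> [|r _]; rewrite !big_nil.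
  have [S' [r0' [S1' S2']]] := ldep_count_poly t.
  exists (S' ++ S), (r0 + r0')%N; split; first by rewrite big_cat /= S1 S1' big_cons.
  move=> r rr; rewrite big_cat big_cons PoszD -S2 -?S2' //.
    by move=> i; apply: leq_trans (rr i); rewrite leq_addl.
  by move=> i; apply: leq_trans (rr i); rewrite leq_addr.
(* [r0] serves the counts, [n] serves [Ndim_sum], and the sum of all shifts keeps the subtractions
   exact. *)
exists (shift_coef (bounds ms n) S), (r0 + n + \sum_(x <- S) \sum_i x.2 i)%N.
split; first by rewrite shift_coef_top.
move=> r rr; rewrite shift_coef_eval => [|x xS i]; last first.
  apply: leq_trans (rr i); rewrite (big_rem x) //= (bigD1 i) //=.
  by rewrite addnCA -addnA leq_addr.
rewrite -S2 => [|i]; last by apply: leq_trans (rr i); rewrite -addnA leq_addr.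
by rewrite Ndim_sum //; apply: leq_trans (rr _); rewrite addnAC leq_addl.
Qed.

Lemma never_dep t r l : never t -> in_Lam ms r l ->
  [ffun u => sgz_neg (l.2 u)] = t.2 -> ~ dep r l t.1.
Proof.
case: t => j e /boolp.asboolP /= nU lr le d; apply: (nU (encode r l)).
  exact: size_encode.
rewrite /ldep -le encodeK; apply: dep_le d => i.
have /vecsP[_ dv] := encode_vecs lr; rewrite /ddeg dv /lowered.
by rewrite addnC -leq_subLR.
Qed.

(* A dependence among the [lact l (eta j)] may be moved into any orthant by the
   automorphisms; if nothing in that orthant depended on smaller elements, then these
   elements would be independent. *)
Lemma never_orthant j e e' : never (j, e) -> never (j, e').
Proof.
move=> nev; apply/boolp.asboolP => w sw /= d.
set r := ddeg e' w in d; set l := decode e' w in d.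
have lr : in_Lam ms r l by apply: decode_in_Lam.
(* Coordinates of elements of [in_Lam ms r] are smaller than [M] in absolute value, so translation
   by [t] moves them all into the orthant [e]. *)
pose M := (r ord_max).+1.
pose t : {ffun 'I_n -> int} := [ffun u => sgn (e u) M].
(* Each of the [n] coordinates of [t] has absolute value at most [M.+1]. *)
pose r' (i : 'I_p.+1) := (r i + n * M.+1)%N.
have rn : (n <= r' ord_max)%N by rewrite /r' mulnS addnCA leq_addr.
have tr mu : in_Lam ms r mu -> in_Lam ms r' (ladd (laut t) mu).
  move=> [mb msig]; split=> [i|];
    first by rewrite ord_blk_laut (leq_trans (mb i)) // leq_addr.
  rewrite /r' addnC -[X in (X * _)%N]card_ord -sum_nat_const.
  apply: leq_trans (_ : \sum_(u : 'I_n) (M.+1 + `|mu.2 u|) <= _)%N; last first.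
    by rewrite big_split leq_add2l.
  apply: leq_sum => u _; rewrite !ffunE.
  exact: abs_sgnD.
have tnd mu : in_Lam ms r mu -> ~ dep r' (ladd (laut t) mu) j.
  move=> mur; apply: (never_dep nev (tr _ mur)); apply/ffunP => u; rewrite !ffunE /=.
  apply: sgz_neg_sgnD; rewrite ltnS.
  by case: mur => _; apply: leq_trans; rewrite /ord_sig (bigD1 u) //= leq_addr.
have [S [SL pw]] := sort_ltk (Lams_uniq rn).
have inS mu j' : in_Lam ms r mu -> (ladd (laut t) mu, j') \in S.
  by move=> mur; rewrite (perm_mem SL); apply/(mem_Lams _ rn); apply: tr.
have ind mu : in_Lam ms r mu ->
    indep_at iota (@ltk m n s) power_product S (ladd (laut t) mu, j).
  by move=> mur; rewrite (indep_at_dep _ rn SL); apply/boolp.asboolP/tnd.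
have [D [kD Dl D0]] :=
  greedy_dual (@ltk_irr m n s) (@ltk_trans m n s) pw (inS _ j lr) (ind _ lr).
suff : D (power_product (ladd (laut t) l, j)) = 0.
  by rewrite Dl => /eqP; rewrite oner_eq0.
(* Translation need not preserve [ltk] here. It keeps the index, though: translates with index [j]
   are independent elements other than the leader, hence killed by [D]; those with smaller index
   remain below every element of index [j]. *)
have : cl iota (fun y => exists t', [/\ in_Lam ms r t'.1, ltk t' (l, j) &
    y = lact (ladd (laut t) t'.1) (eta t'.2)]) (lact (ladd (laut t) l) (eta j)).
  rewrite -lact_add; apply: (cl_laut ext) d => y [t' [tr' tl ->]].
  by rewrite lact_add; apply: cl_in; exists t'.
apply=> // y [[mu j'] [/= mur mul ->]].
have : (j' < j)%N \/ j' = j /\ mu <> l.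
  move: mul; rewrite ltkE => /orP[|/andP[/eqP-> H]]; first by left.
  by right; split=> // E; rewrite E ltnn lexi_irr andbF in H.
case=> [jj|[-> ne]]; last first.
  apply: (D0 (ladd (laut t) mu, j)); [exact: inS | exact: ind |].
  by apply/eqP => E; apply: ne; have /= := congr1 fst E; apply: ladd_inj.
(* For smaller index the translate itself may be dependent, but it is spanned by independent
   elements of index below [j], all killed by [D]. *)
have := greedy_span (iota := iota) (x :=
  power_product) (@ltk_irr m n s) (@ltk_trans m n s)
  pw (inS mu j' mur).
apply=> // _ [k [kS ik klt ->]]; apply: (D0 k) => //; apply/eqP => kE.
case: klt => [|]; rewrite kE; first by move=> [_ _ E]; rewrite E ltnn in jj.
by rewrite ltkE => /orP[|/andP[/eqP E _]];
  [rewrite ltnNge (ltnW jj) | rewrite E ltnn in jj].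
Qed.

Definition nevers : seq 'I_s := [seq j <- enum 'I_s | never (j, [ffun=> false])].

Lemma sum_never : \sum_t (never t)%:Z = (2 ^ n * size nevers)%N%:Z.
Proof.
rewrite -(pair_bigA _ (fun j e => (never (j, e))%:Z)) /=.
transitivity (\sum_(j < s) (2 ^ n * never (j, [ffun=> false]))%N%:Z).
  apply: eq_bigr => j _;
    transitivity (\sum_(e : {ffun 'I_n -> bool}) (never (j, [ffun=> false]))%:Z).
    apply: eq_bigr => e _; congr (Posz (nat_of_bool _)).
    by apply/idP/idP; apply: never_orthant.
  rewrite sumr_const card_ffun card_bool card_ord.
  by case: (never _); rewrite ?muln1 ?muln0 ?mul0rn // natz.
rewrite -(big_morph Posz PoszD (erefl _)) -big_distrr /=; congr (Posz (_ * _)).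
rewrite /nevers size_filter -sum1_count [RHS]big_mkcond [RHS]big_enum /=.
by apply: eq_bigr => j _; case: (never _).
Qed.

Lemma in_Lam_bound (I : finType) (f : I -> Lam m n) :
  exists r, (n <= r ord_max)%N /\ forall i, in_Lam ms r (f i).
Proof.
pose N := (\sum_i (\sum_v (f i).1 v + ord_sig (f i)))%N.
have fN i : (\sum_v (f i).1 v + ord_sig (f i) <= N)%N.
  by rewrite /N (bigD1 i) //= leq_addr.
exists (fun=> n + N)%N; split; first exact: leq_addr.
move=> i; have {}fN := leq_trans (fN i) (leq_addl n N).
split=> [i'|]; last exact: leq_trans (leq_addl _ _) fN.
apply: leq_trans fN; apply: leq_trans (leq_addr _ _); rewrite ord_blkE big_mkcond.
by apply: leq_sum => v _; case: ifP.
Qed.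

(** A relation involves finitely many power products. One [r] contains them all, and there the
    greedy choice keeps each of them and so supplies dual derivations. *)
Lemma nevers_indep : exists xi : 'I_(size nevers) -> L, ds_indep iota xi.
Proof.
pose g i := tnth (in_tuple nevers) i; exists (fun i => eta (g i)) => q f f_inj.
have g_inj : injective g by apply/tuple_uniqP/filter_uniq/enum_uniq.
have gn i e : never (g i, e).
  apply: (@never_orthant _ [ffun=> false]).
  by have := mem_tnth i (in_tuple nevers); rewrite mem_filter => /andP[].
pose h i : Lam m n * 'I_s := ((f i).1, g (f i).2).
have h_inj : injective h.
  move=> i i' [E /g_inj E']; apply: f_inj.
  by move: E E'; case: (f i) (f i') => [? ?] [? ?] /= -> ->.
move=> P P0; apply: (dual_ev_eq0 char0 _ P0) => i.
have [r [rn fr]] := in_Lam_bound (fun i => (f i).1).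
have [S [SL pw]] := sort_ltk (Lams_uniq rn).
have inS i' : h i' \in S by rewrite (perm_mem SL); apply/(mem_Lams _ rn)/fr.
have ind i' : indep_at iota (@ltk m n s) power_product S (h i').
  rewrite (indep_at_dep _ rn SL); apply/boolp.asboolP.
  exact: (never_dep (gn (f i').2 _) (fr i') (erefl _)).
have [D [kD Di D0]] :=
  greedy_dual (@ltk_irr m n s) (@ltk_trans m n s) pw (inS i) (ind i).
exists D; split=> // i'; have [<-//|ii'] := eqVneq i i'.
by apply: (D0 (h i')) => //; rewrite (inj_eq h_inj) eq_sym.
Qed.

(** The derivation dual to the supposed leader kills every smaller power product in the same finite
    range, but not the leader. *)
Lemma ds_indep_never t : ds_indep iota eta -> never t.
Proof.
case: t => j e indep; apply/boolp.asboolP => w sw /= d.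
set r := ddeg e w in d; set l := decode e w in d.
pose r' (i : 'I_p.+1) := (r i + n)%N.
have rn : (n <= r' ord_max)%N by apply: leq_addl.
have lr : (l, j) \in Lams r'.
  apply/(mem_Lams _ rn)/(in_Lam_le _ (decode_in_Lam e sw)) => i; exact: leq_addr.
pose g i := tnth (in_tuple (Lams r')) i.
have g_inj : injective g by apply/tuple_uniqP/Lams_uniq.
have /tnthP[i0 i0E] : (l, j) \in in_tuple (Lams r') by [].
have [D [kD D0]] := alg_indep_dual char0 (indep _ _ g_inj) i0.
have d' : dep r' l j by apply: dep_le d => i; apply: leq_addr.
have : D (power_product (l, j)) = 0.
  apply: d' => // y [t' [tr tl ->]].
  have /tnthP[i1 i1E] : t' \in in_tuple (Lams r') by apply/(mem_Lams _ rn).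
  have := D0 i1; rewrite /g -i1E => ->; case: eqP => // E.
  by rewrite i1E -E -i0E ltk_irr in tl.
have := D0 i0; rewrite /g -i0E eqxx => -> /eqP; by rewrite oner_eq0.
Qed.

End Counting.

End Leaders.

(** * Comparison of two systems of generators *)

(** [ord_blk] describes the blocks by intervals of partial sums; [blk] names the block of each
    derivation, so that sums split into fibres. *)
Lemma blocks_exist (m p : nat) (ms : 'I_p -> nat) : (\sum_(i < p) ms i)%N = m ->
  exists blk : 'I_m -> 'I_p,
    (forall (v : 'I_m) (i : 'I_p),
      (\sum_(j < p | (j < i)%N) ms j <= v < \sum_(j < p | (j <= i)%N) ms j)%N = (blk v
        == i)) /\
    forall i : 'I_p, #|[pred v | blk v == i]| = ms i.
Proof.
move=> msm; pose lo (i : nat) := (\sum_(j < p | (j < i)%N) ms j)%N.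
have hiE (i : 'I_p) : lo i.+1 = (lo i + ms i)%N.
  rewrite /lo (bigD1 i) //= addnC; congr (_ + _)%N; apply: eq_bigl => j.
  by rewrite ltnS andbC -(inj_eq val_inj) -ltn_neqAle.
have lo_le i i' : (i <= i')%N -> (lo i <= lo i')%N.
  move=> ii; rewrite /lo big_mkcond [X in (_ <= X)%N]big_mkcond; apply: leq_sum => j _.
  by case: ifP => // ji; rewrite (leq_trans ji ii).
have lop : lo p = m by rewrite -msm; apply: eq_bigl => j; rewrite ltn_ord.
have ex (v : 'I_m) : exists i : 'I_p, (lo i <= v < lo i.+1)%N.
  have exk : exists k, (v < lo k)%N by exists p; rewrite lop.
  have [[|k] vk kmin] := ex_minnP exk.
    by move: vk; rewrite /lo big_pred0.
  have kp : (k < p)%N by apply: kmin; rewrite lop.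
  exists (Ordinal kp); rewrite vk andbT leqNgt; apply/negP => /kmin.
  by rewrite ltnn.
pose blk v := proj1_sig (constructive_indefinite_description _ (ex v)).
have blkE (v : 'I_m) : (lo (blk v) <= v < lo (blk v).+1)%N.
  by rewrite /blk; case: constructive_indefinite_description.
have uniq (v : 'I_m) (i : 'I_p) : (lo i <= v < lo i.+1)%N = (blk v == i).
  apply/idP/eqP => [/andP[a b]|<-//]; have /andP[c d] := blkE v.
  apply/val_inj/eqP; rewrite eqn_leq /=; apply/andP; split; rewrite leqNgt;
    apply/negP => /lo_le.
    by rewrite leqNgt (leq_ltn_trans c b).
  by rewrite leqNgt (leq_ltn_trans a d).
exists blk; split=> [v i|i]; first by rewrite -uniq.
have -> : ms i = (\sum_(lo i <= v < lo i.+1) 1)%N.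
  by rewrite sum_nat_const_nat muln1 hiE addKn.
have him : (lo i.+1 <= m)%N by rewrite -lop lo_le.
rewrite (big_nat_widenl _ _ _ _ _ (leq0n (lo i))) (big_nat_widen _ _ _ _ _ him).
by rewrite big_mkord -sum1_card; apply: eq_bigl => v; rewrite inE -uniq.
Qed.

Section Comparison.
Variables (m n p : nat) (ms : 'I_p -> nat) (blk : 'I_m -> 'I_p).
Hypothesis blkP : forall (v : 'I_m) (i : 'I_p),
  (\sum_(j < p | (j < i)%N) ms j <= v < \sum_(j < p | (j <= i)%N) ms j)%N = (blk v == i).
Variables (K L : dsFieldType m n) (iota : {rmorphism K -> L}).
Hypothesis ext : ds_extension iota.

Section Shifts.
Variables (s : nat) (eta : 'I_s -> L).
Implicit Types (r : 'I_p.+1 -> nat) (x : L).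

Lemma cl_Lam_le r r' x : (forall i, r i <= r' i)%N ->
  cl iota (Lam_eta ms eta r) x -> cl iota (Lam_eta ms eta r') x.
Proof.
move=> rr; apply: cl_sub => y [j [l [lr ->]]]; exists j, l; split=> //.
exact: in_Lam_le lr.
Qed.

Lemma cl_Lam_der v r x : cl iota (Lam_eta ms eta r) x ->
  cl iota (Lam_eta ms eta (fun i => r i + (i == lift ord_max (blk v)))%N) (der v x).
Proof.
apply: (cl_der ext) => y [j [l [lr ->]]]; split; apply: cl_in.
  by exists j, l; split=> //; apply: in_Lam_le lr => i; apply: leq_addr.
by rewrite der_lact; exists j, (ladd (lder v) l); split=> //; apply: (in_Lam_lder blkP).
Qed.
Arguments cl_Lam_der v {r x}.

Lemma cl_Lam_iter v c r x : cl iota (Lam_eta ms eta r) x ->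
  cl iota (Lam_eta ms eta (fun i => r i + (i == lift ord_max (blk v)) * c)%N)
    (iter c (der v) x).
Proof.
move=> rx; elim: c => [|c IHc]; first by apply: cl_Lam_le rx => i; apply: leq_addr.
by apply: cl_Lam_le (cl_Lam_der v IHc) => i; rewrite mulnS; lia.
Qed.
Arguments cl_Lam_iter v c {r x}.

Lemma cl_Lam_dact (k : 'I_m -> nat) q r x : cl iota (Lam_eta ms eta r) x ->
  cl iota (Lam_eta ms eta
    (fun i => r i + \sum_(v <- q) (i == lift ord_max (blk v)) * k v)%N) (dact k q x).
Proof.
move=> rx; elim: q => [|v q IHq]; first by apply: cl_Lam_le rx => i; apply: leq_addr.
apply: cl_Lam_le (cl_Lam_iter v (k v) IHq) => i.
by rewrite big_cons -addnA leq_add2l addnC.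
Qed.
Arguments cl_Lam_dact k q {r x}.

Lemma cl_Lam_laut (t : {ffun 'I_n -> int}) r x : cl iota (Lam_eta ms eta r) x ->
  cl iota (Lam_eta ms eta (fun i => r i + (i == ord_max) * \sum_j `|t j|)%N)
    (lact (laut t) x).
Proof.
apply: (cl_laut ext) => y [j [l [[lb ls] ->]]]; apply: cl_in; rewrite lact_add.
exists j, (ladd (laut t) l); split=> //; split=> [i|].
  by rewrite (ord_blk_laut blkP) (leq_trans (lb i)) // leq_addr.
rewrite eqxx mul1n addnC; apply: leq_trans (_ : \sum_u (`|t u| + `|l.2 u|) <= _)%N.
  have absD (z z' : int) : (`|(z + z')%R| <= `|z| + `|z'|)%N by lia.
  by apply: leq_sum => u _; rewrite ffunE; apply: absD.
by rewrite big_split /= leq_add2l.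
Qed.
Arguments cl_Lam_laut t {r x}.

Lemma cl_Lam_lact C l r x : in_Lam ms r l -> cl iota (Lam_eta ms eta (fun=> C)) x ->
  cl iota (Lam_eta ms eta (fun i => r i + C)%N) (lact l x).
Proof.
move=> [lb ls] /(cl_Lam_laut l.2)/(cl_Lam_dact l.1 (enum 'I_m)).
rewrite lact_lautE -lactE; apply: cl_Lam_le => i'; rewrite big_enum /=.
case: (unliftP ord_max i') => [i ->|->].
  rewrite lift_max_eq addn0 addnC leq_add2r; apply: leq_trans (lb i).
  rewrite (ord_blkE blkP) [X in (_ <= X)%N]big_mkcond; apply: leq_sum => v _.
  by rewrite (inj_eq (@lift_inj _ _)) eq_sym; case: eqP; rewrite ?mul1n.
rewrite eqxx mul1n [X in (_ + X <= _)%N]big1 ?addn0 => [|v _]; last first.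
  by rewrite eq_sym lift_max_eq.
by rewrite addnC leq_add2r.
Qed.

(** The elements for which some [C] exists form a Delta-sigma-subfield containing [K] and all
    [eta j], hence everything. *)
Lemma gen_bounded x : ds_generates iota eta ->
  exists C, cl iota (Lam_eta ms eta (fun=> C)) x.
Proof.
move=> gen; have mono C C' y : (C <= C')%N ->
    cl iota (Lam_eta ms eta (fun=> C)) y -> cl iota (Lam_eta ms eta (fun=> C')) y.
  by move=> CC; apply: cl_Lam_le.
have unit1 C (j : 'I_n) z : `|z|%N = 1%N -> forall i, ((fun=> C) i +
    (i == ord_max :> 'I_p.+1) * \sum_(u < n) `|(unitz j z) u|%N <= C.+1)%N.
  move=> z1 i; rewrite (bigD1 j) //= ffunE eqxx z1 big1 ?addn0.
    by rewrite muln1 -[C.+1]addn1 leq_add2l leq_b1.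
  by move=> u uj; rewrite ffunE (negbTE uj).
apply: (gen x (fun x => exists C, cl iota (Lam_eta ms eta (fun=> C)) x)).
- split.
  + by exists 0%N; case: (cl_subfield iota (Lam_eta ms eta (fun=> 0%N))).
  + move=> y z [C yC] [C' zC]; exists (C + C')%N.
    case: (cl_subfield iota (Lam_eta ms eta (fun=> (C + C')%N))) => _ HB _.
    by apply: HB; [apply: mono yC; apply: leq_addr | apply: mono zC; apply: leq_addl].
  + move=> y z [C yC] [C' zC]; exists (C + C')%N.
    case: (cl_subfield iota (Lam_eta ms eta (fun=> (C + C')%N))) => _ _ HV.
    by apply: HV; [apply: mono yC; apply: leq_addr | apply: mono zC; apply: leq_addl].
- split=> [i y [C yC]|j y [C yC]|j y [C yC]]; exists C.+1.
  + by apply: cl_Lam_le (cl_Lam_der i yC) => i'; rewrite -[C.+1]addn1 leq_add2l leq_b1.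
  + have := cl_Lam_laut (unitz j 1) yC; rewrite lact_laut; apply: cl_Lam_le.
    exact: unit1.
  + have := cl_Lam_laut (unitz j (-1)) yC; rewrite lact_laut; apply: cl_Lam_le.
    exact: unit1.
- by move=> c; exists 0%N; apply: cl_iota.
- move=> _ [j ->]; exists 0%N; apply: cl_in; exists j, ([ffun=> 0%N], [ffun=> 0]).
  split; last by rewrite lactE dact0 /aact; elim: (enum 'I_n) => //= u q <-;
    rewrite ffunE.
  split=> [i|]; first by rewrite /ord_blk big1 // => v _; rewrite ffunE.
  by rewrite /ord_sig big1 // => u _; rewrite ffunE.
Qed.

Lemma gen_family_bounded s' (eta' : 'I_s' -> L) : ds_generates iota eta ->
  exists C, forall j, cl iota (Lam_eta ms eta (fun=> C)) (eta' j).
Proof.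
move=> gen; pose f j := constructive_indefinite_description _ (gen_bounded (eta' j) gen).
exists (\sum_j proj1_sig (f j))%N => j; apply: cl_Lam_le (proj2_sig (f j)) => i.
by rewrite (bigD1 j) //= leq_addr.
Qed.

End Shifts.

Hypothesis char0 : forall k, k.+1%:R != 0 :> L.
Hypothesis blk_card : forall i : 'I_p, #|[pred v | blk v == i]| = ms i.

Lemma Ndim_le s s' (eta : 'I_s -> L) (eta' : 'I_s' -> L) : ds_generates iota eta ->
  exists C, forall r, (n <= r ord_max)%N ->
    (Ndim ms blk iota eta' r <= Ndim ms blk iota eta (fun i => r i + C))%N.
Proof.
move=> gen; have [C etaC] := gen_family_bounded eta' gen; exists C => r rn.
have [[x [xF xind]] _] := trdeg_adjoin blkP iota eta' char0 rn.
have rC : (n <= r ord_max + C)%N by apply: leq_trans rn _; apply: leq_addr.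
(* Taking the closure itself for [F] gives it transcendence degree [Ndim] at [r + C], so it bounds
   any independent family inside it. *)
have [_] := trdeg_Ndim blkP char0 (F := cl iota (Lam_eta ms eta (fun i => r i + C)%N)) rC
  (fun y => @cl_in _ _ iota _ y) (fun z Fz => Fz).
apply=> //; last exact: xind.
move=> i; have := adjoin_cl (xF i); apply: cl_trans => _ [j [l [lr ->]]].
exact: cl_Lam_lact.
Qed.

Lemma Ndim_asymp s s' (eta : 'I_s -> L) (eta' : 'I_s' -> L) (P P' : {mpoly rat[p.+1]})
  r0 :
  ds_generates iota eta ->
  (forall r, (forall i, r0 <= r i)%N -> P.@[fun i =>
    (r i)%:R] = (Ndim ms blk iota eta r)%:R) ->
  (forall r, (forall i, r0 <= r i)%N -> P'.@[fun i =>
    (r i)%:R] = (Ndim ms blk iota eta' r)%:R) ->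
  asymp_le P' P.
Proof.
move=> gen PE PE'; have [C NC] := Ndim_le eta' gen.
exists (r0 + n)%N, (fun=> C) => r rr.
rewrite PE' => [|i]; last by apply: leq_trans (rr i); apply: leq_addr.
rewrite PE => [|i]; last by rewrite (leq_trans _ (leq_addr _ _)) // (leq_trans _ (rr
  i)) ?leq_addr.
by rewrite ler_nat NC // (leq_trans _ (rr _)) // leq_addl.
Qed.

End Comparison.

(** One inequality suffices: within the box only the top exponent reaches total degree [D], so the
    weight-1 part is a single monomial, evaluated at the all-ones point. *)
Lemma asymp_top_coef_le q (b : 'I_q -> nat) (a a' : 'X_{1..q} -> int) :
  asymp_le (binom_expansion b a) (binom_expansion b a') ->
  a [multinom b i | i < q] <= a' [multinom b i | i < q].
Proof.
set top := [multinom _ | _ < q]; move=> [r0 [c le]]; pose D := mdeg top.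
have below (e : 'X_{1..q}) : (forall i, e i <= b i)%N -> (e <= top)%MM.
  by move=> eb; apply/mnm_lepP => i; rewrite mnmE.
have bnd a0 f : f \in msupp (binom_expansion b a0) -> (f <= top)%MM.
  move=> /msupp_binom_expansion[e [[/below etop _] /mnm_lepP fe]].
  by apply/mnm_lepP => i; apply: leq_trans (fe i) _; apply/mnm_lepP.
have bD a0 f : f \in msupp (binom_expansion b a0) -> (wt (fun=> 1%N) f <= D)%N.
  by rewrite /D -wt1 => /bnd/wt_le.
have wE a0 : (wpart (fun=> 1%N) D (binom_expansion b a0)).@[fun=> 1%:R] =
    (a0 top)%:~R * fact_inv top.
  have -> : wpart (fun=> 1%N) D (binom_expansion b a0) =
      (binom_expansion b a0)@_top *: 'X_[top].
    apply/mpolyP => e; rewrite mcoeff_wpart mcoeffZ mcoeffX.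
    have [<-|ne] := eqVneq top e; first by rewrite wt1 eqxx mulr1.
    rewrite mulr0; case: eqP => // eD; apply/memN_msupp_eq0/negP => /bnd etop.
    case/eqP: ne; apply/esym; apply: (@wt_eq _ (fun=> 1%N)) => //.
    by rewrite eD wt1.
  rewrite mevalZ mevalX big1 ?mulr1 => [|i _]; last by rewrite expr1n.
  apply: (@mcoeff_binom_expansion _ _ _ (fun=> 1%N) D) => //.
  - by move=> e [/below/wt_le etop _]; rewrite /D -wt1.
  - by move=> i; rewrite mnmE.
  - exact: wt1.
have := wpart_le (w := fun=> 1%N) (x :=
  fun=> 1%N) (fun=> isT) (fun=> isT) (bD a) (bD a') le.
rewrite !wE ler_pM2r ?ler_int // /fact_inv; apply: prodr_gt0 => i _.
by rewrite invr_gt0 ltr0n fact_gt0.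
Qed.

Lemma is_trdeg_uniq m n (K L : dsFieldType m n) (iota : {rmorphism K -> L}) F d d' :
  is_trdeg iota F d -> is_trdeg iota F d' -> d = d'.
Proof.
move=> [[x [Fx ix]] le] [[x' [Fx' ix']] le']; apply/eqP; rewrite eqn_leq.
by rewrite (le' _ _ Fx ix) (le _ _ Fx' ix').
Qed.

(** Ties an arbitrary dimension polynomial to the count, by uniqueness of the transcendence
    degree. *)
Lemma dim_poly_Ndim m n p (ms : 'I_p -> nat) (blk : 'I_m -> 'I_p)
    (K L : dsFieldType m n) (iota : {rmorphism K -> L}) s (eta : 'I_s -> L) Phi :
  (forall (v : 'I_m) (i : 'I_p),
    (\sum_(j < p | (j < i)%N) ms j <= v < \sum_(j < p | (j <= i)%N) ms j)%N = (blk v ==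
      i)) ->
  (forall k, k.+1%:R != 0 :> L) ->
  is_dim_poly iota ms eta Phi ->
  exists r0 : nat, forall r, (forall i, r0 <= r i)%N ->
    Phi.@[fun i => (r i)%:R] = (Ndim ms blk iota eta r)%:R.
Proof.
move=> blkP char0 [r1 H]; exists (\sum_i r1 i + n)%N => r rr.
have [|d [dr ->]] := H r.
  by move=> i; apply: leq_trans (rr i); rewrite (bigD1 i) //= -addnA leq_addr.
congr (_%:R); apply: is_trdeg_uniq dr _; apply: trdeg_adjoin => //.
by apply: leq_trans (rr _); apply: leq_addl.
Qed.

Lemma bounds_lift p (ms : 'I_p -> nat) n i : bounds ms n (lift ord_max i) = ms i.
Proof. by rewrite /bounds liftK. Qed.

Lemma bounds_max p (ms : 'I_p -> nat) n : bounds ms n ord_max = n.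
Proof. by rewrite /bounds unlift_none. Qed.

Lemma sum_bounds p (ms : 'I_p -> nat) n :
  (\sum_i bounds ms n i = \sum_i ms i + n)%N.
Proof.
rewrite (bigD1_ord ord_max) //= bounds_max addnC; congr (_ + _)%N.
by apply: eq_bigr => i _; rewrite bounds_lift.
Qed.

Lemma msupp_binom_le q (b : 'I_q -> nat) a (f : 'X_{1..q}) i :
  f \in msupp (binom_expansion b a) -> (f i <= b i)%N.
Proof.
move=> /msupp_binom_expansion[e [[eb _] /mnm_lepP fe]].
exact: leq_trans (fe i) (eb i).
Qed.

Theorem theorem3p1 (m n p : nat) (ms : 'I_p -> nat)
  (K L : dsFieldType m n) (iota : {rmorphism K -> L})
  (s : nat) (eta : 'I_s -> L)
  (p_ge1 : (1 <= p)%N)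
  (m_sum : (\sum_(i < p) ms i)%N = m)
  (char0 : [pchar K] =i pred0)
  (extKL : ds_extension iota)
  (gen_eta : ds_generates iota eta) :
  let b := bounds ms n in
  let top := [multinom b i | i < p.+1] in
  exists Phi : {mpoly rat[p.+1]},
    is_dim_poly iota ms eta Phi /\
    (forall i : 'I_p, (deg_in (lift ord_max i) Phi <= ms i)%N) /\
    (deg_in ord_max Phi <= n)%N /\
    (msize Phi <= (m + n).+1)%N /\
    exists a : 'X_{1..p.+1} -> int,
      Phi = binom_expansion b a /\
      ((2 ^ n)%N%:Z %| a top)%Z /\
      (forall (s' : nat) (eta' : 'I_s' -> L) (Phi' : {mpoly rat[p.+1]})
              (a' : 'X_{1..p.+1} -> int),
         ds_generates iota eta' ->
         is_dim_poly iota ms eta' Phi' ->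
         Phi' = binom_expansion b a' ->
         [/\ msize Phi' = msize Phi,
             a' top = a top,
             forall e, lex_maximal (coef_supp b a') e <->
                       lex_maximal (coef_supp b a) e,
             forall e, lex_maximal (coef_supp b a) e -> a' e = a e
           & forall e : 'X_{1..p.+1}, (mdeg e).+1 = msize Phi ->
               Phi'@_e = Phi@_e]) /\
      exists k : nat, is_ds_trdeg iota k /\ a top = (2 ^ n * k)%N%:Z.
Proof.
move=> b top; have [blk [blkP blk_card]] := blocks_exist m_sum.
have charL k : k.+1%:R != 0 :> L.
  by rewrite -(rmorph_nat iota) fmorph_eq0 ((pcharf0P _).1 char0).
have [a [r1 [atop aev]]] := Ndim_poly blkP extKL eta blk_card.
rewrite (sum_never blkP extKL eta) -/b -/top in atop.
pose k := size (nevers ms blk iota eta).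
exists (binom_expansion b a); split.
  exists (fun=> r1 + n)%N => r rr; exists (Ndim ms blk iota eta r); split.
    apply: trdeg_adjoin => //; apply: leq_trans (rr _); exact: leq_addl.
  by apply: aev => i; apply: leq_trans (rr i); apply: leq_addr.
have degb i : (deg_in i (binom_expansion b a) <= b i)%N.
  by apply/bigmax_leqP_seq => e /(@msupp_binom_le _ b a e i).
split; first by move=> i; have := degb (lift ord_max i); rewrite /b bounds_lift.
split; first by have := degb ord_max; rewrite /b bounds_max.
split.
  rewrite msizeE; apply/bigmax_leqP_seq => e eP _; rewrite ltnS -m_sum -sum_bounds mdegE.
  by apply: leq_sum => i _; apply: (@msupp_binom_le _ b a e i).
exists a; split => //; split; first by rewrite atop PoszM dvdz_mulr.
(* The first bound holds for any finite family, because [eta] generates; the second asks the same of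
   [eta']. Independent families use the first bound only. *)
have comp s' (eta' : 'I_s' -> L) Phi' r' :
    (forall r, (forall i, r' <= r i)%N ->
      Phi'.@[fun i => (r i)%:R] = (Ndim ms blk iota eta' r)%:R) ->
    asymp_le Phi' (binom_expansion b a) /\
    (ds_generates iota eta' -> asymp_le (binom_expansion b a) Phi').
  move=> E'; have E1 r : (forall i, r' + r1 <= r i)%N ->
      (binom_expansion b a).@[fun i => (r i)%:R] = (Ndim ms blk iota eta r)%:R.
    by move=> rr; apply: aev => i; apply: leq_trans (rr i); apply: leq_addl.
  have E2 r : (forall i, r' + r1 <= r i)%N ->
      Phi'.@[fun i => (r i)%:R] = (Ndim ms blk iota eta' r)%:R.
    by move=> rr; apply: E' => i; apply: leq_trans (rr i); apply: leq_addr.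
  split; first exact: (Ndim_asymp blkP extKL charL gen_eta E1 E2).
  by move=> gen'; apply: (Ndim_asymp blkP extKL charL gen' E2 E1).
split.
  move=> s' eta' Phi' a' gen' dim' E'.
  have [r' N'] := dim_poly_Ndim blkP charL dim'.
  have [le1 /(_ gen') le2] := comp _ _ _ _ N'.
  rewrite E' in le1 le2 *.
  have a'top : a' top = a top.
    by apply/eqP; rewrite eq_le (asymp_top_coef_le le1) (asymp_top_coef_le le2).
  split => //.
  - by apply/eqP; rewrite eqn_leq !asymp_msize_le.
  - by move=> e; split=> [/(lex_maximal_asymp le1 le2)[]|/(lex_maximal_asymp le2 le1)[]].
  - by move=> e /(lex_maximal_asymp le2 le1)[].
  - by move=> e eP; apply/esym; apply: asymp_top.
exists k; split; last exact: atop.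
split; first exact: nevers_indep.
move=> k' xi xi_indep.
(* The count is applied to [xi] in place of generators; its independence makes the top coefficient
   [2^n k']. *)
have [c [r' [ctop cev]]] := Ndim_poly blkP extKL xi blk_card.
have [le1 _] := comp _ _ _ _ cev.
have := asymp_top_coef_le le1; rewrite -/top atop ctop (sum_never blkP extKL xi).
rewrite lez_nat leq_pmul2l ?expn_gt0 // => /(leq_trans _); apply.
rewrite /nevers (eq_filter (a2 := predT)) ?filter_predT ?size_enum_ord //.
by move=> j /=; rewrite (ds_indep_never blkP charL).
Qed.
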